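(* Let $(M,g,u,\mathfrak{f})$ be a skew-torsion Lorentzian three-manifold such that $$\mathrm{d}\mathfrak{f}(n)+\mathfrak{f}^2=0$$ for any, and hence for all, null coframes $(u,v,n)\in\mathcal{P}_u$ associated to $u$. Then the foliation $\mathcal{X}_u$ of $M$ associated to $u$ carries an affine structure induced by the Levi-Civita connection $\nabla^g$; that is, $\nabla^g$ restricts to a flat torsion-free connection on each leaf of $\mathcal{X}_u$.
   Context: A skew-torsion Lorentzian three-manifold is a tuple $(M,g,u,\mathfrak{f})$ where $(M,g)$ is a connected, oriented and time-oriented, strongly spin Lorentzian three-manifold (signature $(2,1)$), $\mathfrak{f}\in C^{\infty}(M)$, and $u\in\Omega^1(M)$ is a nowhere vanishing isotropic one-form with $\nabla^gu=\mathfrak{f}\ast_gu$ (the two-form $\ast_gu$ viewed as a skew tensor; $\alpha\wedge\ast_g\beta=g(\alpha,\beta)\nu_g$). Strongly spin means spin and such that every spin structure reduces to the identity component of the spin group. A null coframe $(u,v,n)\in\mathcal{P}_u$ consists of $u$, an isotropic one-form $v$ with $g(u,v)=1$ and $n=-\ast_g(u\wedge v)$; $\mathrm{d}\mathfrak{f}(n)$ means $\mathrm{d}\mathfrak{f}(n^{\sharp_g})$. $\mathcal{X}_u$ is the codimension-one foliation integrating the (integrable) distribution $\ker u=u^{\perp_g}\subset TM$, which is preserved by $\nabla^g$. *)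

(* Defs.v *)
From mathcomp Require Import all_boot all_order all_algebra.
From mathcomp Require Import all_classical all_reals all_analysis.
From mathcomp Require Import ring.

Set Implicit Arguments.
Unset Strict Implicit.
Unset Printing Implicit Defensive.

Import Order.TTheory GRing.Theory Num.Theory.
Import numFieldNormedType.Exports.

Local Open Scope classical_set_scope.
Local Open Scope ring_scope.

(** * Smooth manifolds *)

(* [cmap] and [cinv] are total; only their values on [cdom] and on its image
   matter. *)
Record chart (R : realType) (n : nat) (M : topologicalType) := Chart {
  cdom : set M;
  cmap : M -> 'rV[R]_n;
  cinv : 'rV[R]_n -> M }.

Definition is_chart (R : realType) (n : nat) (M : topologicalType)
    (c : chart R n M) : Prop :=
  [/\ open (cdom c), open (cmap c @` cdom c),
      {in cdom c, cancel (cmap c) (cinv c)},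
      {within cdom c, continuous (cmap c)} &
      {within cmap c @` cdom c, continuous (cinv c)}].

(* The i-th partial derivative, in the coordinates c, of a function on M. *)
Definition pd (R : realType) (n : nat) (M : topologicalType) (c : chart R n M)
    (i : 'I_n) (F : M -> R) (p : M) : R :=
  'D_(delta_mx 0 i) (F \o cinv c) (cmap c p).

(* All partial derivatives of F of order at most k in the coordinates c are
   differentiable at every point of W in the domain of c; W is always open. *)
Fixpoint diff_upto (R : realType) (n : nat) (M : topologicalType) (k : nat)
    (c : chart R n M) (W : set M) (F : M -> R) : Prop :=
  (forall p, cdom c p -> W p -> differentiable (F \o cinv c) (cmap c p)) /\
  (if k is k'.+1 then forall i, diff_upto k' c W (pd c i F) else True).

Definition csmooth (R : realType) (n : nat) (M : topologicalType)
    (c : chart R n M) (W : set M) (F : M -> R) : Prop :=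
  forall k, diff_upto k c W F.

Record manifold (R : realType) (n : nat) := Manifold {
  space :> topologicalType;
  atlas : set (chart R n space);
  manifold_hausdorff : hausdorff_space space;
  manifold_countable : @second_countable space;
  manifold_chart : forall c, atlas c -> is_chart c;
  manifold_cover : forall p, exists2 c, atlas c & cdom c p;
  manifold_compat : forall c d, atlas c -> atlas d ->
    forall j, csmooth c (cdom d) (fun p => cmap d p 0 j) }.

Arguments atlas {R n} m _.

Definition smooth_function (R : realType) (n : nat) (M : manifold R n)
    (f : M -> R) : Prop :=
  forall c, atlas M c -> csmooth c setT f.

Definition smooth_map (R : realType) (m n : nat) (L : manifold R m)
    (M : manifold R n) (F : L -> M) : Prop :=
  continuous F /\
  forall b c, atlas L b -> atlas M c ->
    forall j, csmooth b (F @^-1` cdom c) (fun q => cmap c (F q) 0 j).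

(* First and second derivatives of F in the coordinates b and c.  The Jacobian
   acts on the right of row vectors: row i is dF(d/dx^i). *)
Definition jac (R : realType) (m n : nat) (L : manifold R m) (M : manifold R n)
    (F : L -> M) (b : chart R m L) (c : chart R n M) (q : L) : 'M[R]_(m, n) :=
  \matrix_(i, j) pd b i (fun q' => cmap c (F q') 0 j) q.

Definition hess (R : realType) (m n : nat) (L : manifold R m) (M : manifold R n)
    (F : L -> M) (b : chart R m L) (c : chart R n M) (q : L)
    (i j : 'I_m) (k : 'I_n) : R :=
  pd b i (pd b j (fun q' => cmap c (F q') 0 k)) q.

Definition trans (R : realType) (n : nat) (M : manifold R n)
    (c d : chart R n M) (p : M) : 'M[R]_n :=
  jac (id : M -> M) c d p.

Definition oriented (R : realType) (n : nat) (M : manifold R n) : Prop :=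
  forall c d p, atlas M c -> atlas M d -> cdom c p -> cdom d p ->
    0 < \det (trans c d p).

(** * Tensor fields and connections, by their components in each chart *)

(* A k-tuple of smooth vector fields on the open set W, one per row. *)
Definition vector_fields (R : realType) (n k : nat) (M : manifold R n)
    (W : set M) (X : chart R n M -> M -> 'M[R]_(k, n)) : Prop :=
  (forall c i j, atlas M c -> csmooth c W (fun p => X c p i j)) /\
  (forall c d p, atlas M c -> atlas M d -> cdom c p -> cdom d p -> W p ->
     X d p = X c p *m trans c d p).

Definition one_form (R : realType) (n : nat) (M : manifold R n)
    (a : chart R n M -> M -> 'rV[R]_n) : Prop :=
  (forall c i, atlas M c -> csmooth c setT (fun p => a c p 0 i)) /\
  (forall c d p, atlas M c -> atlas M d -> cdom c p -> cdom d p ->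
     a c p = a d p *m (trans c d p)^T).

(* The metric diag(1, 1, -1) of signature (2, 1). *)
Definition minkowski (R : realType) : 'M[R]_3 :=
  diag_mx (\row_(i < 3) (-1) ^+ (i == ord_max)).

Definition lorentzian_metric (R : realType) (M : manifold R 3)
    (g : chart R 3 M -> M -> 'M[R]_3) : Prop :=
  [/\ forall c i j, atlas M c -> csmooth c setT (fun p => g c p i j),
      forall c d p, atlas M c -> atlas M d -> cdom c p -> cdom d p ->
        g c p = trans c d p *m g d p *m (trans c d p)^T,
      forall c p, atlas M c -> cdom c p -> (g c p)^T = g c p &
      forall c p, atlas M c -> cdom c p ->
        exists2 P : 'M[R]_3, P \in unitmx & P *m g c p *m P^T = minkowski R].

(* [D c p i j k] is the Christoffel symbol: the component along d/dx^k of the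
   derivative of d/dx^j in the direction d/dx^i. *)
Definition symbols (R : realType) (n : nat) (M : manifold R n) : Type :=
  chart R n M -> M -> 'I_n -> 'I_n -> 'I_n -> R.

(* The pullback by F of the connection D on TM, applied to the fields dF(Y)
   with Y tangent to L, is dF(E Y):
   d_i d_j F^k + D_ab^k d_i F^a d_j F^b = E_ij^l d_l F^k. *)
Definition intertwines (R : realType) (m n : nat) (L : manifold R m)
    (M : manifold R n) (F : L -> M) (E : symbols L) (D : symbols M) : Prop :=
  forall b c q, atlas L b -> atlas M c -> cdom b q -> cdom c (F q) ->
  forall i j k,
    hess F b c q i j k +
      \sum_x \sum_y D c (F q) x y k * jac F b c q i x * jac F b c q j y =
    \sum_l E b q i j l * jac F b c q l k.

(* For F the identity, [intertwines] is the transformation law of Christoffel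
   symbols. *)
Definition connection (R : realType) (n : nat) (M : manifold R n)
    (D : symbols M) : Prop :=
  (forall c i j k, atlas M c -> csmooth c setT (fun p => D c p i j k)) /\
  intertwines (id : M -> M) D D.

Definition torsion_free (R : realType) (n : nat) (M : manifold R n)
    (D : symbols M) : Prop :=
  forall c p i j k, atlas M c -> cdom c p -> D c p i j k = D c p j i k.

(* Component along d/dx^l of R(d/dx^i, d/dx^j) d/dx^k. *)
Definition curvature (R : realType) (n : nat) (M : manifold R n)
    (D : symbols M) (c : chart R n M) (p : M) (i j k l : 'I_n) : R :=
  pd c i (fun q => D c q j k l) p - pd c j (fun q => D c q i k l) p +
  \sum_m (D c p i m l * D c p j k m - D c p j m l * D c p i k m).

Definition flat (R : realType) (n : nat) (M : manifold R n)
    (D : symbols M) : Prop :=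
  forall c p i j k l, atlas M c -> cdom c p -> curvature D c p i j k l = 0.

Definition metric_connection (R : realType) (n : nat) (M : manifold R n)
    (g : chart R n M -> M -> 'M[R]_n) (D : symbols M) : Prop :=
  forall c p i j k, atlas M c -> cdom c p ->
    pd c i (fun q => g c q j k) p =
    \sum_l (D c p i j l * g c p l k + D c p i k l * g c p j l).

Definition levi_civita (R : realType) (n : nat) (M : manifold R n)
    (g : chart R n M -> M -> 'M[R]_n) (D : symbols M) : Prop :=
  [/\ connection D, torsion_free D & metric_connection g D].

(* Entry (i, j) is the value on d/dx^j of the derivative of a along d/dx^i. *)
Definition covariant_derivative (R : realType) (n : nat) (M : manifold R n)
    (D : symbols M) (a : chart R n M -> M -> 'rV[R]_n) (c : chart R n M)
    (p : M) : 'M[R]_n :=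
  \matrix_(i, j)
    (pd c i (fun q => a c q 0 j) p - \sum_k D c p i j k * a c p 0 k).

Definition differential (R : realType) (n : nat) (M : manifold R n)
    (f : M -> R) (c : chart R n M) (p : M) : 'rV[R]_n :=
  \row_i pd c i f p.

(** * Exterior and metric algebra at a point, in positively oriented
      coordinates *)

(* One-forms are rows and two-forms skew-symmetric matrices; a three-form is
   represented by its coefficient on dx^0 /\ dx^1 /\ dx^2; G is the matrix of
   the metric. *)
Definition sharp (R : realType) (G : 'M[R]_3) (a : 'rV[R]_3) : 'rV[R]_3 :=
  a *m invmx G.

Definition ip1 (R : realType) (G : 'M[R]_3) (a b : 'rV[R]_3) : R :=
  (a *m invmx G *m b^T) 0 0.

Definition ip2 (R : realType) (G A B : 'M[R]_3) : R :=
  2^-1 * \tr (invmx G *m A *m invmx G *m B^T).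

Definition wedge1 (R : realType) (a b : 'rV[R]_3) : 'M[R]_3 :=
  a^T *m b - b^T *m a.

Definition wedge12 (R : realType) (a : 'rV[R]_3) (B : 'M[R]_3) : R :=
  a 0 0 * B 1 2 + a 0 1 * B 2 0 + a 0 2 * B 0 1.

Definition vol_coef (R : realType) (G : 'M[R]_3) : R := Num.sqrt `|\det G|.

Definition vol (R : realType) (G : 'M[R]_3) (x y z : 'rV[R]_3) : R :=
  vol_coef G * \det (\matrix_(i < 3) nth 0 [:: x; y; z] i).

(* The Hodge star; [star1P] and [star2P] below are its defining property. *)
Definition star1 (R : realType) (G : 'M[R]_3) (a : 'rV[R]_3) : 'M[R]_3 :=
  \matrix_(j, k) vol G (sharp G a) (delta_mx 0 j) (delta_mx 0 k).

Definition star2 (R : realType) (G B : 'M[R]_3) : 'rV[R]_3 :=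
  \row_i (2^-1 * \sum_j \sum_k (invmx G *m B *m (invmx G)^T) j k *
                   vol G (delta_mx 0 j) (delta_mx 0 k) (delta_mx 0 i)).

(** * Spin structures in signature (2, 1) *)

Definition quadratic (R : realType) (x : 'rV[R]_3) : R :=
  (x *m minkowski R *m x^T) 0 0.

(* Clifford multiplication on R^2, see [cliffordP].  The even part of the
   Clifford algebra is represented faithfully by 2 x 2 matrices, so that the
   group generated by the even products of unit vectors is Spin(2, 1). *)
Definition clifford (R : realType) (x : 'rV[R]_3) : 'M[R]_2 :=
  x 0 0 *: (delta_mx 0 0 - delta_mx 1 1) +
  x 0 1 *: (delta_mx 0 1 + delta_mx 1 0) +
  x 0 2 *: (delta_mx 0 1 - delta_mx 1 0).

Definition Spin (R : realType) : set 'M[R]_2 :=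
  [set A | exists s : seq 'rV[R]_3,
     [/\ ~~ odd (size s),
         all (fun x => (quadratic x == 1) || (quadratic x == -1)) s &
         A = \prod_(x <- s) clifford x]].

Arguments Spin : clear implicits.

Definition Spin0 (R : realType) : set 'M[R]_2 :=
  connected_component (Spin R) 1.

Arguments Spin0 : clear implicits.

(* The two-fold cover Spin(2, 1) -> SO(2, 1) maps A to Q. *)
Definition spin_covers (R : realType) (A : 'M[R]_2) (Q : 'M[R]_3) : Prop :=
  forall x : 'rV[R]_3, clifford x *m A = A *m clifford (x *m Q).

Definition open_cover (M : topologicalType) (I : Type) (W : I -> set M) : Prop :=
  (forall i, open (W i)) /\ (forall p, exists i, W i p).

(* A spin structure given by a cocycle: local oriented orthonormal frames
   (the rows of [sp_frame i c p] are the frame vectors) together with a lift to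
   Spin(2, 1) of their transition functions. *)
Record spin_data (R : realType) (M : manifold R 3) := SpinData {
  sp_idx : Type;
  sp_cover : sp_idx -> set M;
  sp_frame : sp_idx -> chart R 3 M -> M -> 'M[R]_3;
  sp_lift : sp_idx -> sp_idx -> M -> 'M[R]_2 }.

Definition spin_structure (R : realType) (M : manifold R 3)
    (g : chart R 3 M -> M -> 'M[R]_3) (s : spin_data M) : Prop :=
  let W := @sp_cover R M s in
  let E := @sp_frame R M s in
  let h := @sp_lift R M s in
  [/\ open_cover W,
      forall i, vector_fields (W i) (E i) /\
        forall c p, atlas M c -> cdom c p -> W i p ->
          E i c p *m g c p *m (E i c p)^T = minkowski R /\
          0 < \det (E i c p),
      forall i j, {within W i `&` W j, continuous (h i j)} /\
        forall p, W i p -> W j p -> Spin R (h i j p),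
      forall i j c p, atlas M c -> cdom c p -> W i p -> W j p ->
        exists2 Q : 'M[R]_3, spin_covers (h i j p) Q &
          E i c p = Q *m E j c p &
      forall i j k p, W i p -> W j p -> W k p ->
        h i j p *m h j k p = h i k p].

(* Over some refinement the cocycle is cohomologous to one with values in the
   identity component. *)
Definition spin_reduces (R : realType) (M : manifold R 3) (s : spin_data M) :
    Prop :=
  exists (J : Type) (V : J -> set M) (r : J -> sp_idx s) (k : J -> M -> 'M[R]_2),
    [/\ open_cover V,
        forall a, V a `<=` sp_cover (r a),
        forall a, {within V a, continuous (k a)} /\
          forall p, V a p -> Spin R (k a p) &
        forall a b p, V a p -> V b p ->
          Spin0 R (k a p *m sp_lift (r a) (r b) p *m invmx (k b p))].

Definition strongly_spin (R : realType) (M : manifold R 3)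
    (g : chart R 3 M -> M -> 'M[R]_3) : Prop :=
  (exists s : spin_data M, spin_structure g s) /\
  (forall s : spin_data M, spin_structure g s -> spin_reduces s).

(** * Skew-torsion Lorentzian three-manifolds *)

(* A time orientation is given by a timelike vector field. *)
Definition time_orientation (R : realType) (M : manifold R 3)
    (g : chart R 3 M -> M -> 'M[R]_3) (T : chart R 3 M -> M -> 'rV[R]_3) : Prop :=
  vector_fields setT T /\
  forall c p, atlas M c -> cdom c p -> (T c p *m g c p *m (T c p)^T) 0 0 < 0.

Record skew_torsion_manifold (R : realType) (M : manifold R 3)
    (g : chart R 3 M -> M -> 'M[R]_3) (T : chart R 3 M -> M -> 'rV[R]_3)
    (D : symbols M) (u : chart R 3 M -> M -> 'rV[R]_3) (f : M -> R) : Prop :=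
  SkewTorsionManifold {
  st_connected : connected [set: M];
  st_oriented : oriented M;
  st_metric : lorentzian_metric g;
  st_time : time_orientation g T;
  st_spin : strongly_spin g;
  st_levi_civita : levi_civita g D;
  st_smooth : smooth_function f;
  st_one_form : one_form u;
  st_nowhere_zero : forall c p, atlas M c -> cdom c p -> u c p != 0;
  st_isotropic : forall c p, atlas M c -> cdom c p ->
    ip1 (g c p) (u c p) (u c p) = 0;
  st_equation : forall c p, atlas M c -> cdom c p ->
    covariant_derivative D u c p = f p *: star1 (g c p) (u c p) }.

(* (u, v, n) belongs to P_u. *)
Record null_coframe (R : realType) (M : manifold R 3)
    (g : chart R 3 M -> M -> 'M[R]_3)
    (u v n : chart R 3 M -> M -> 'rV[R]_3) : Prop := NullCoframe {
  nc_one_form : one_form v;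
  nc_isotropic : forall c p, atlas M c -> cdom c p ->
    ip1 (g c p) (v c p) (v c p) = 0;
  nc_conjugate : forall c p, atlas M c -> cdom c p ->
    ip1 (g c p) (u c p) (v c p) = 1;
  nc_normal : forall c p, atlas M c -> cdom c p ->
    n c p = - star2 (g c p) (wedge1 (u c p) (v c p)) }.

(* df(n) + f^2 = 0 *)
Definition flatness_condition (R : realType) (M : manifold R 3)
    (g : chart R 3 M -> M -> 'M[R]_3) (f : M -> R)
    (n : chart R 3 M -> M -> 'rV[R]_3) : Prop :=
  forall c p, atlas M c -> cdom c p ->
    (differential f c p *m (sharp (g c p) (n c p))^T) 0 0 + f p ^+ 2 = 0.

(** * The foliation tangent to the kernel of u *)

(* An injectively immersed surface whose tangent planes are the planes ker u. *)
Definition integral_surface (R : realType) (M : manifold R 3)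
    (u : chart R 3 M -> M -> 'rV[R]_3) (L : manifold R 2) (F : L -> M) : Prop :=
  [/\ smooth_map F, injective F &
      forall b c q, atlas L b -> atlas M c -> cdom b q -> cdom c (F q) ->
        row_free (jac F b c q) /\
        (jac F b c q == kermx (u c (F q))^T)%MS].

(* The leaves are the maximal connected integral surfaces. *)
Definition leaf (R : realType) (M : manifold R 3)
    (u : chart R 3 M -> M -> 'rV[R]_3) (L : manifold R 2) (F : L -> M) : Prop :=
  [/\ integral_surface u F, connected [set: L] &
      forall (L' : manifold R 2) (F' : L' -> M),
        integral_surface u F' -> connected [set: L'] ->
        range F `<=` range F' -> range F' `<=` range F].

Definition leafwise_affine (R : realType) (M : manifold R 3)
    (u : chart R 3 M -> M -> 'rV[R]_3) (D : symbols M) : Prop :=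
  forall (L : manifold R 2) (F : L -> M), leaf u F ->
    exists E : symbols L,
      [/\ connection E, intertwines F E D, torsion_free E & flat E].

(** * Checks of the conventions *)

Lemma sum3E (V : nmodType) (F : 'I_3 -> V) : \sum_i F i = F 0 + F 1 + F 2.
Proof.
rewrite !big_ord_recr big_ord0 /= add0r.
by congr (F _ + F _ + F _); apply: val_inj.
Qed.

Lemma sum2E (V : nmodType) (F : 'I_2 -> V) : \sum_i F i = F 0 + F 1.
Proof.
rewrite !big_ord_recr big_ord0 /= add0r.
by congr (F _ + F _); apply: val_inj.
Qed.

Lemma det3E (R : realType) (x y z : 'rV[R]_3) :
  \det (\matrix_(i < 3) nth 0 [:: x; y; z] i) =
  x 0 0 * (y 0 1 * z 0 2 - y 0 2 * z 0 1) +
  x 0 1 * (y 0 2 * z 0 0 - y 0 0 * z 0 2) +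
  x 0 2 * (y 0 0 * z 0 1 - y 0 1 * z 0 0).
Proof.
have nE (t : 'rV[R]_3) : exists T : nat -> R, forall i, t 0 i = T i.
  by exists (fun k => t 0 (inord k)) => i; rewrite inord_val.
rewrite (expand_det_row _ 0) sum3E /cofactor.
rewrite !(expand_det_row _ (0 : 'I_2)) !sum2E /cofactor !det_mx11 !mxE /=.
have [[X hX] [Y hY] [Z hZ]] := And3 (nE x) (nE y) (nE z).
rewrite !hX !hY !hZ /= /bump /=; ring.
Qed.

Lemma star1P (R : realType) (G : 'M[R]_3) (a b : 'rV[R]_3) :
  G^T = G -> wedge12 b (star1 G a) = ip1 G b a * vol_coef G.
Proof.
move=> hG; have hI : (invmx G)^T = invmx G by rewrite trmx_inv hG.
have -> : ip1 G b a = \sum_i b 0 i * sharp G a 0 i.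
  rewrite /ip1 -mulmxA -{1}hI -trmx_mul mxE.
  by apply: eq_bigr => i _; rewrite [_^T _ _]mxE.
rewrite sum3E /wedge12 ![star1 _ _ _ _]mxE /vol !det3E.
rewrite ![delta_mx _ _ _ _]mxE /=; ring.
Qed.

Lemma star2P (R : realType) (G A B : 'M[R]_3) :
  G^T = G -> A^T = - A -> wedge12 (star2 G B) A = ip2 G A B * vol_coef G.
Proof.
move=> hG hA; have hI : (invmx G)^T = invmx G by rewrite trmx_inv hG.
pose C := invmx G *m B *m (invmx G)^T.
have -> : ip2 G A B = 2^-1 * \sum_i \sum_j A i j * C i j.
  rewrite /ip2 -!mulmxA mxtrace_mulC -!mulmxA; congr (_ * _).
  apply: eq_bigr => i _; rewrite mxE; apply: eq_bigr => j _.
  have -> : invmx G *m (B^T *m invmx G) = C^T.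
    by rewrite /C !trmx_mul trmxK hI.
  by rewrite [_^T _ _]mxE.
have sA i j : A j i = - A i j.
  by have := congr1 (fun X : 'M[R]_3 => X i j) hA; rewrite !mxE.
have dA i : A i i = 0.
  by have /eqP := sA i i; rewrite -addr_eq0 -mulr2n mulrn_eq0 => /eqP.
rewrite /wedge12 ![star2 _ _ _ _]mxE -/C !sum3E /vol !det3E.
rewrite ![delta_mx _ _ _ _]mxE /=.
rewrite !dA (sA 0 1) (sA 0 2) (sA 1 2); ring.
Qed.

Lemma cliffordP (R : realType) (x : 'rV[R]_3) :
  clifford x *m clifford x = (quadratic x)%:M.
Proof.
have -> : quadratic x = x 0 0 ^+ 2 + x 0 1 ^+ 2 - x 0 2 ^+ 2.
  rewrite /quadratic /minkowski mul_mx_diag mxE sum3E !mxE /=; ring.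
apply/matrixP => i j; rewrite mxE sum2E !mxE.
by case: i => -[|[|//]] ?; case: j => -[|[|//]] ? /=; ring.
Qed.

(* Main.v *)
Require Import Defs.
From mathcomp Require Import all_boot all_order all_algebra.
From mathcomp Require Import all_classical all_reals all_analysis.
From mathcomp Require Import ring lra.

(* Write [nabla u = f (n (x) u - u (x) n)] for a null coframe [(u, v, n)].
   Differentiating [g(n, n) = 1] and [g(n, u) = 0] gives
   [nabla_a n = f u_a v] modulo [u], and the Ricci identity then expresses the
   contraction [R_abk^l u_l] through [df], [f ^ 2] and the coframe.  Its cyclic
   sum is the first Bianchi identity, which amounts to [df /\ n /\ u = 0], that
   is [df(u) = 0]: this makes [df(n)] independent of the coframe.  If moreover
   [df(n) + f ^ 2 = 0], then [R_abk^l u_l] is a multiple of [u_k], and the pair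
   symmetry of the curvature yields [R(X, Y) = 0] for [X], [Y] in [ker u].
   On a leaf, [nabla] preserves [ker u], hence induces a torsion-free
   connection; its curvature is the pullback of [R], so that it vanishes. *)

Set Implicit Arguments.
Unset Strict Implicit.
Unset Printing Implicit Defensive.

Import Order.TTheory GRing.Theory Num.Theory.
Import numFieldNormedType.Exports.

Local Open Scope classical_set_scope.
Local Open Scope ring_scope.

(** * Differential calculus on normed spaces *)

(** The planes [ker u] are degenerate for [g], as they contain [u^#], so the leaves inherit no
    metric from which a connection could be read off. Instead [E *m jac = pullback] is solved for
    the symbols [E] on the leaf. Tangency makes it solvable and injectivity of the Jacobian makes
    the solution unique. The transformation law, symmetry and flatness of [E] are all proved by
    multiplying by the Jacobian and cancelling it afterwards. The condition on [f] acts on a single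
    coefficient. In [R_abk^l u_l] the part along [n_k] carries the factor [df(n) + f^2]; the part
    along [u_k] is harmless, because pair symmetry lets the slot [k] receive only vectors of
    [ker u]. As [ker u] is spanned by [u^#] and [n^#], only [R(n^#, u^#)] has to vanish. Smoothness
    means differentiability of all iterated partial derivatives. The symmetry of second derivatives,
    on which the Ricci identity, the skewness of the curvature and the curvature of the leaf rest,
    is therefore derived from differentiability alone. *)

Lemma near_eq_differentiable (R : numFieldType) (V W : normedModType R)
    (f g : V -> W) (x : V) :
  {near x, f =1 g} -> differentiable f x -> differentiable g x.
Proof.
move=> fg df; have [dc /eqaddoP fo] := (diff_locallyP x f).1 df.
suff go : g \o shift x = cst (g x) + 'd f x +o_ 0 id.
  by apply/diff_locallyP; rewrite (diff_unique dc go).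
apply/eqaddoP => e e0; have := fo e e0.
apply: filterS2; last first.
  have : \forall y \near x, f y = g y by exact: fg.
  by rewrite (near_shift 0 x); apply.
by move=> h /=; rewrite subr0 -[(_ - _) h]/(_ - _) -[(g \o _ - _) h]/(_ - _) /=
  (nbhs_singleton fg) => ->.
Qed.

Lemma differentiable_remainder (R : realType) (V : normedModType R)
    (f : V -> R) (x : V) (e : R) : differentiable f x -> 0 < e ->
  exists2 r : R, 0 < r & forall h, `|h| < r ->
    `|f (x + h) - f x - 'd f x h| <= e * `|h|.
Proof.
move=> df e0; have [dc /eqaddoP fo] := (diff_locallyP x f).1 df.
have /nbhs_ballP[r r0 hr] := fo e e0.
exists r => // h hh; have := hr h.
rewrite -ball_normE /= sub0r normrN => /(_ hh).
rewrite -[(_ - _) h]/(_ - _) /=.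
by rewrite -[(cst _ + _) h]/(f x + 'd f x h) opprD addrA [h + x]addrC.
Qed.

Lemma is_derive_line (R : realType) (V : normedModType R) (f : V -> R)
    (x a : V) (t : R) : differentiable f (x + t *: a) ->
  is_derive t 1 (fun s => f (x + s *: a)) ('D_a f (x + t *: a)).
Proof.
move=> /diff_derivable - /(_ a) df.
have E : (fun h : R => h^-1 *: ((fun s => f (x + s *: a)) (h *: 1 + t)
    - f (x + t *: a))) = (fun h => h^-1 *: (f (h *: a + (x + t *: a)) -
    f (x + t *: a))).
  apply/funext => h; congr (_ *: (f _ - _)).
  by rewrite [h *: 1]mulr1 scalerDl addrCA.
by apply: DeriveDef; rewrite /derivable /derive /= E.
Qed.

(* The double difference of [phi] along [a] and [b], divided by [h ^ 2], tends
   to the iterated derivative, by the mean value theorem along [a]. *)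
Lemma double_difference (R : realType) (V : normedModType R) (phi : V -> R)
    (x a b : V) (e : R) :
  (\forall y \near x, differentiable phi y) -> differentiable ('D_a phi) x ->
  0 < e ->
  exists2 r : R, 0 < r & forall h, 0 < h < r ->
    `|phi (x + h *: a + h *: b) - phi (x + h *: a) - phi (x + h *: b) + phi x
      - h ^+ 2 * 'D_b ('D_a phi) x| <= e * h ^+ 2.
Proof.
move=> /nbhs_ballP[r1 r10 nphi] dpsi e0.
(* For [0 < c < h] the two increments below satisfy [|c a + h b| + |c a| <= h (2 |a| + |b|)]. The
   summand 1 keeps [K] positive when [a = b = 0]. *)
set psi := 'D_a phi; set K := 2 * `|a| + `|b| + 1.
have K0 : 0 < K by rewrite ltr_wpDl ?addr_ge0 ?mulr_ge0.
have [r2 r20 rem] := differentiable_remainder dpsi (divr_gt0 e0 K0).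
set r := Num.min r1 r2; have r0 : 0 < r by rewrite lt_min r10.
exists (r / K); first exact: divr_gt0.
move=> h /andP[h0]; rewrite ltr_pdivlMr // => hr.
have small s : 0 <= s <= h -> `|s *: a| < r /\ `|s *: a + h *: b| < r.
  move=> /andP[s0 sh]; have ha : `|s *: a| <= h * `|a|.
    by rewrite normrZ ger0_norm // ler_wpM2r.
  have hb : `|h *: b| <= h * `|b| by rewrite normrZ gtr0_norm.
  split; apply: le_lt_trans hr.
    apply: le_trans ha _; rewrite ler_pM2l // /K -addrA ler_wpDr ?addr_ge0 //.
    by rewrite mulr_natl mulr2n lerDl.
  apply: le_trans (ler_normD _ _) _; apply: le_trans (lerD ha hb) _.
  rewrite -mulrDr ler_pM2l // /K -addrA lerD // ?lerDl //.
  by rewrite mulr_natl mulr2n lerDl.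
have dphi k : `|k| < r -> differentiable phi (x + k).
  move=> kr; apply: nphi; rewrite -ball_normE /= opprD addrA subrr sub0r normrN.
  by apply: lt_le_trans kr _; rewrite ge_min lexx.
pose g s := phi (x + s *: a + h *: b) - phi (x + s *: a).
pose dg s := psi (x + s *: a + h *: b) - psi (x + s *: a).
have gd s : 0 <= s <= h -> is_derive s 1 g (dg s).
  move=> hs; have [sm1 sm2] := small s hs.
  apply: is_deriveB; last by apply: is_derive_line; apply: dphi.
  rewrite /psi -addrA [_ + h *: b]addrC addrA.
  rewrite (_ : (fun _ => _) = (fun s => phi (x + h *: b + s *: a))).
    by apply: is_derive_line; rewrite -addrA [h *: b + _]addrC; apply: dphi.
  by apply/funext => t; rewrite -!addrA [h *: b + _]addrC.
have [c ch gE] : exists2 c, c \in `]0, h[%R & g h - g 0 = dg c * (h - 0).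
  apply: MVT => // [s|].
    by rewrite in_itv /= => /andP[/ltW ? /ltW ?]; apply: gd; apply/andP.
  apply: derivable_within_continuous => s; rewrite in_itv /= => hs.
  by have [] := gd s hs.
move: ch; rewrite in_itv /= => /andP[c0 ch].
have c0h : 0 <= c <= h by rewrite !ltW.
have [sm1 sm2] := small c c0h.
have lt2 (k : V) : `|k| < r -> `|k| < r2.
  by move=> kr; apply: lt_le_trans kr _; rewrite ge_min lexx orbT.
have R1 := rem _ (lt2 _ sm1); have R2 := rem _ (lt2 _ sm2).
rewrite (_ : _ - _ = h * (dg c - h * 'D_b psi x)); last first.
  rewrite mulrBr mulrA -expr2; congr (_ - _).
  have -> : h * dg c = g h - g 0 by rewrite gE subr0 mulrC.
  by rewrite /g !scale0r !addr0 opprB [phi x - _]addrC !addrA.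
rewrite normrM gtr0_norm // expr2 mulrCA ler_pM2l //.
rewrite (deriveE _ dpsi).
(* Both values of [psi] are expanded at [x]. Their linear parts differ by exactly [h * 'd psi x b],
   so only two first-order remainders are left. *)
have -> : dg c - h * 'd psi x b =
  (psi (x + (c *: a + h *: b)) - psi x - 'd psi x (c *: a + h *: b)) -
  (psi (x + c *: a) - psi x - 'd psi x (c *: a)).
  have dhb : 'd psi x (h *: b) = h * 'd psi x b by rewrite linearZ.
  by rewrite linearD dhb /dg addrA; ring.
apply: le_trans (ler_normB _ _) _; apply: le_trans (lerD R2 R1) _.
rewrite -mulrDr mulrAC ler_pdivrMr // -mulrA ler_pM2l //.
have ha : `|c *: a| <= h * `|a|.
  by rewrite normrZ gtr0_norm // ler_wpM2r // ltW.
have hb : `|h *: b| <= h * `|b| by rewrite normrZ gtr0_norm.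
apply: le_trans (lerD (ler_normD _ _) (lexx _)) _.
apply: le_trans (lerD (lerD ha hb) ha) _.
rewrite addrAC -mulr2n -mulr_natl mulrCA -mulrDr ler_pM2l // /K.
by rewrite lerDl.
Qed.

(** Young's form of the symmetry theorem. The double difference is symmetric in [a] and [b], and
    [double_difference] evaluates it to second order in both ways. *)
Lemma derive_sym (R : realType) (V : normedModType R) (phi : V -> R)
    (x a b : V) :
  (\forall y \near x, differentiable phi y) ->
  differentiable ('D_a phi) x -> differentiable ('D_b phi) x ->
  'D_a ('D_b phi) x = 'D_b ('D_a phi) x.
Proof.
move=> dphi da db; apply/eqP; rewrite -subr_eq0 -normr_le0.
apply/ler_addgt0Pr => e e0; rewrite add0r.
have e20 : 0 < e / 2 by apply: divr_gt0.
have [r1 r10 h1] := double_difference b dphi da e20.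
have [r2 r20 h2] := double_difference a dphi db e20.
pose h := Num.min r1 r2 / 2.
have m0 : 0 < Num.min r1 r2 by rewrite lt_min r10.
have h0 : 0 < h by apply: divr_gt0.
have hm : h < Num.min r1 r2.
  by rewrite /h ltr_pdivrMr // mulr_natr mulr2n ltrDl.
have {}h1 := h1 h _; have {}h2 := h2 h _.
have /h1 H1 : 0 < h < r1 by rewrite h0 (lt_le_trans hm) // ge_min lexx.
have /h2 H2 : 0 < h < r2 by rewrite h0 (lt_le_trans hm) // ge_min lexx orbT.
have hh : 0 < h ^+ 2 by apply: exprn_gt0.
rewrite -(ler_pM2l hh) -[X in X * `|_|]gtr0_norm // -normrM.
move: H1 H2; set X := phi _ - _ - _ + _; set A := 'D_b _ x.
set B := 'D_a _ x => H1 H2.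
have -> : h ^+ 2 * (B - A) = (X - h ^+ 2 * A) -
   (phi (x + h *: b + h *: a) - phi (x + h *: b) - phi (x + h *: a) + phi x
      - h ^+ 2 * B).
  by rewrite /X -(addrA x (h *: b)) [h *: b + _]addrC addrA; ring.
apply: le_trans (ler_normB _ _) _; apply: le_trans (lerD H1 H2) _.
by rewrite -mulrDl -splitr mulrC.
Qed.

(** * Partial derivatives and smooth functions in a chart *)

Lemma open_interior_in (T : topologicalType) (A : set T) (x : T) :
  open A -> A x -> A° x.
Proof. by move=> /interior_id ->. Qed.

Section ChartCalculus.
Context (R : realType) (n : nat) (M : topologicalType).
Implicit Types (c : chart R n M) (F G : M -> R) (W : set M) (p : M).

Definition diff_at c F p : Prop := differentiable (F \o cinv c) (cmap c p).

(** [cinv c] is continuous only within the image of the chart; as this image is open, the restricted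
    neighbourhoods of [cmap c p] are full ones. This is what makes the values of [cmap] and [cinv]
    outside the chart irrelevant to derivatives. *)
Lemma chart_near c W p : is_chart c -> open W -> cdom c p -> W p ->
  \forall y \near cmap c p,
    [/\ cdom c (cinv c y), W (cinv c y) & cmap c (cinv c y) = y].
Proof.
move=> [od oi cK cc ic] oW dp Wp.
have ip : (cmap c @` cdom c) (cmap c p) by exists p.
have icp : cinv c y @[y --> within (cmap c @` cdom c) (nbhs (cmap c p))] -->
    cinv c (cmap c p) by move/subspace_continuousP: ic => /(_ _ ip).
rewrite (within_interior (open_interior_in oi ip)) in icp.
have cKp : cinv c (cmap c p) = p by apply: cK; rewrite inE.
rewrite cKp in icp.
have nW : \forall q \near p, cdom c q /\ W q.
  by apply: open_nbhs_nbhs; split => //; apply: openI.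
have nd : \forall y \near cmap c p, cdom c (cinv c y) /\ W (cinv c y) := icp _ nW.
have ni : nbhs (cmap c p) (cmap c @` cdom c) by apply: open_nbhs_nbhs.
apply: filterS2 nd ni => y /= [dy Wy] [q dq yE].
by split=> //; rewrite -yE; congr (cmap c _); apply: cK; rewrite inE.
Qed.

Lemma pdE c i F p : diff_at c F p ->
  pd c i F p = 'd (F \o cinv c) (cmap c p) (delta_mx 0 i).
Proof. exact: deriveE. Qed.

Lemma comp_near c W F G p : is_chart c -> open W -> cdom c p -> W p ->
  (forall q, cdom c q -> W q -> F q = G q) ->
  {near cmap c p, F \o cinv c =1 G \o cinv c}.
Proof.
move=> hc oW dp Wp FG; have := chart_near hc oW dp Wp.
by apply: filterS => y [? ? _] /=; apply: FG.
Qed.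

Lemma pd_near c W i F G p : is_chart c -> open W -> cdom c p -> W p ->
  (forall q, cdom c q -> W q -> F q = G q) -> pd c i F p = pd c i G p.
Proof.
by move=> hc oW dp Wp FG; apply: near_eq_derive; apply: (comp_near hc oW).
Qed.

Lemma diff_near c W F G p : is_chart c -> open W -> cdom c p -> W p ->
  (forall q, cdom c q -> W q -> F q = G q) -> diff_at c F p -> diff_at c G p.
Proof.
move=> hc oW dp Wp FG; apply: near_eq_differentiable.
exact: (comp_near hc oW).
Qed.

Lemma cinvK c p : is_chart c -> cdom c p -> cinv c (cmap c p) = p.
Proof. by move=> [_ _ cK _ _] dp; rewrite cK ?inE. Qed.

Lemma diff_at_cst c a p : diff_at c (fun=> a) p.
Proof. exact: differentiable_cst. Qed.

Lemma pd_cst c i a p : pd c i (fun=> a) p = 0.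
Proof. exact: derive_cst. Qed.

Lemma diff_atD c F G p : diff_at c F p -> diff_at c G p ->
  diff_at c (fun q => F q + G q) p.
Proof. exact: differentiableD. Qed.

Lemma pdD c i F G p : diff_at c F p -> diff_at c G p ->
  pd c i (fun q => F q + G q) p = pd c i F p + pd c i G p.
Proof. by move=> dF dG; apply: deriveD; apply: diff_derivable. Qed.

Lemma diff_atN c F p : diff_at c F p -> diff_at c (fun q => - F q) p.
Proof. exact: differentiableN. Qed.

Lemma pdN c i F p : diff_at c F p -> pd c i (fun q => - F q) p = - pd c i F p.
Proof. by move=> dF; apply: deriveN; apply: diff_derivable. Qed.

Lemma diff_atM c F G p : diff_at c F p -> diff_at c G p ->
  diff_at c (fun q => F q * G q) p.
Proof. exact: differentiableM. Qed.

Lemma pdM c i F G p : is_chart c -> cdom c p -> diff_at c F p ->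
  diff_at c G p ->
  pd c i (fun q => F q * G q) p = pd c i F p * G p + F p * pd c i G p.
Proof.
move=> hc dp dF dG.
have := @deriveM _ _ (F \o cinv c) (G \o cinv c) (cmap c p) (delta_mx 0 i)
  (diff_derivable dF) (diff_derivable dG).
by rewrite /= !cinvK // addrC [G p *: _]mulrC.
Qed.

Lemma diff_at_sum c (I : Type) (r : seq I) (P : pred I) (F : I -> M -> R) p :
  (forall i, P i -> diff_at c (F i) p) ->
  diff_at c (fun q => \sum_(i <- r | P i) F i q) p.
Proof.
move=> dF; elim: r => [|j r IH].
  rewrite (_ : (fun q => _) = fun=> 0); first exact: diff_at_cst.
  by apply/funext => q; rewrite big_nil.
rewrite (_ : (fun q => _) = fun q => if P j then F j q +
  \sum_(i <- r | P i) F i q else \sum_(i <- r | P i) F i q); last first.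
  by apply/funext => q; rewrite big_cons.
by case Pj: (P j) => //; apply: diff_atD => //; apply: dF.
Qed.

Lemma pd_sum c j (I : Type) (r : seq I) (P : pred I) (F : I -> M -> R) p :
  (forall i, P i -> diff_at c (F i) p) ->
  pd c j (fun q => \sum_(i <- r | P i) F i q) p =
  \sum_(i <- r | P i) pd c j (F i) p.
Proof.
move=> dF; elim: r => [|k r IH].
  by rewrite big_nil -[RHS](pd_cst c j 0 p); congr (pd c j _ p);
     apply/funext => q; rewrite big_nil.
rewrite (_ : (fun q => _) = fun q => if P k then F k q +
  \sum_(i <- r | P i) F i q else \sum_(i <- r | P i) F i q); last first.
  by apply/funext => q; rewrite big_cons.
rewrite big_cons; case Pk: (P k) => //.
by rewrite pdD ?IH //; [apply: dF|apply: diff_at_sum].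
Qed.

Lemma diff_atV c F p : is_chart c -> cdom c p -> F p != 0 -> diff_at c F p ->
  diff_at c (fun q => (F q)^-1) p.
Proof.
by move=> hc dp F0 dF; apply: differentiableV => //=; rewrite cinvK //.
Qed.

Lemma pdV c i F p : is_chart c -> cdom c p -> F p != 0 -> diff_at c F p ->
  pd c i (fun q => (F q)^-1) p = - (pd c i F p * ((F p)^-1 * (F p)^-1)).
Proof.
move=> hc dp F0 dF; rewrite [LHS](@deriveV _ _ (F \o cinv c)) /= ?cinvK //.
  by rewrite -expr2 exprVn -[_ *: _]/(_ * _) mulNr mulrC.
exact: diff_derivable.
Qed.

Lemma diff_at_sqrt c F p : is_chart c -> cdom c p -> 0 < F p ->
  diff_at c F p -> diff_at c (fun q => Num.sqrt (F q)) p.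
Proof.
move=> hc dp F0 dF; apply: (differentiable_comp dF).
apply/derivable1_diffP; rewrite /= cinvK //.
by have [] := is_derive1_sqrt F0.
Qed.

Lemma pd_sqrt c i F p : is_chart c -> cdom c p -> 0 < F p ->
  diff_at c F p ->
  pd c i (fun q => Num.sqrt (F q)) p = pd c i F p * (2 * Num.sqrt (F p))^-1.
Proof.
move=> hc dp F0 dF; rewrite (pdE _ dF).
have ds := is_derive1_sqrt F0.
have dsF : differentiable (Num.sqrt : R -> R) ((F \o cinv c) (cmap c p)).
  by apply/derivable1_diffP; rewrite /= cinvK //; have [] := ds.
rewrite (pdE _ (diff_at_sqrt hc dp F0 dF)).
rewrite (diff_comp dF dsF) /= cinvK //.
move: dsF; rewrite /= cinvK // => dsF.
move: ('d _ _ (delta_mx 0 i)) => z.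
have {1}-> : z = z *: (1 : R^o) by rewrite -[z *: _]/(z * 1) mulr1.
by rewrite linearZ /= -(deriveE _ dsF) (@derive_val _ _ _ _ _ _ _ ds).
Qed.

Lemma pd_sym c W i j F p : is_chart c -> open W -> cdom c p -> W p ->
  (forall q, cdom c q -> W q -> diff_at c F q) ->
  diff_at c (pd c i F) p -> diff_at c (pd c j F) p ->
  pd c i (pd c j F) p = pd c j (pd c i F) p.
Proof.
move=> hc oW dp Wp dF di dj.
(* The two functions agree only near the point, since [pd] evaluates at [cmap c (cinv c y)], which
   is [y] only on the image of the chart. *)
have pdn k : {near cmap c p, pd c k F \o cinv c =1
                             'D_(delta_mx 0 k) (F \o cinv c)}.
  by have := chart_near hc oW dp Wp; apply: filterS => y [? ? e]; rewrite /= /pd e.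
rewrite /pd (near_eq_derive _ (pdn j)) (near_eq_derive _ (pdn i)).
apply: derive_sym.
- have := chart_near hc oW dp Wp; apply: filterS => y [? ? e].
  by rewrite -e; apply: dF.
- exact: near_eq_differentiable (pdn i) di.
- exact: near_eq_differentiable (pdn j) dj.
Qed.

End ChartCalculus.

(** * Closure properties of smooth functions in a chart *)

Section SmoothFunctions.
Context (R : realType) (n : nat) (M : topologicalType).
Implicit Types (c : chart R n M) (F G : M -> R) (W : set M) (p : M).

Lemma diff_uptoW k c W F : diff_upto k.+1 c W F -> diff_upto k c W F.
Proof.
elim: k F => [|k IH] F [h1 h2]; split => // i.
exact: IH (h2 i).
Qed.

Lemma diff_upto_at k c W F p : diff_upto k c W F -> cdom c p -> W p ->
  diff_at c F p.
Proof. by case: k => [|k] [h _]; apply: h. Qed.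

Lemma diff_upto_ext k c W F G : is_chart c -> open W ->
  (forall q, cdom c q -> W q -> F q = G q) ->
  diff_upto k c W F -> diff_upto k c W G.
Proof.
move=> hc oW; elim: k F G => [|k IH] F G FG [h1 h2]; split => //.
- by move=> p dp Wp; apply: (diff_near hc oW dp Wp FG); apply: h1.
- by move=> p dp Wp; apply: (diff_near hc oW dp Wp FG); apply: h1.
- move=> i; apply: IH (h2 i) => q dq Wq; exact: pd_near hc oW dq Wq FG.
Qed.

(** Each clause of [diff_upto] is a condition at one point, so [W'] may vary with the point. This
    allows the target chart to change from point to point in [induced_smooth]. *)
Lemma diff_upto_local k c W F :
  (forall p, cdom c p -> W p -> exists2 W', W' p & diff_upto k c W' F) ->
  diff_upto k c W F.
Proof.
elim: k F => [|k IH] F h; split => //.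
- by move=> p dp Wp; have [W' W'p /diff_upto_at] := h p dp Wp; apply.
- by move=> p dp Wp; have [W' W'p /diff_upto_at] := h p dp Wp; apply.
- by move=> i; apply: IH => p dp Wp; have [W' W'p [_ h2]] := h p dp Wp;
  exists W' => //; exact: h2.
Qed.

Lemma diff_upto_cst k c W a : is_chart c -> open W ->
  diff_upto k c W (fun=> a).
Proof.
move=> hc oW; elim: k a => [|k IH] a; split => //;
  try by move=> *; exact: diff_at_cst.
by move=> i; apply: (diff_upto_ext hc oW _ (IH 0)) => q _ _; rewrite pd_cst.
Qed.

Lemma diff_uptoD k c W F G : is_chart c -> open W ->
  diff_upto k c W F -> diff_upto k c W G ->
  diff_upto k c W (fun q => F q + G q).
Proof.
move=> hc oW; elim: k F G => [|k IH] F G hF hG.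
  by split=> // p dp Wp; apply: diff_atD;
    [apply: (diff_upto_at hF)|apply: (diff_upto_at hG)].
split=> [p dp Wp|i].
  by apply: diff_atD;
    [apply: (diff_upto_at hF)|apply: (diff_upto_at hG)].
apply: (diff_upto_ext hc oW _ (IH _ _ (hF.2 i) (hG.2 i))) => q dq Wq.
by rewrite pdD //;
    [apply: (diff_upto_at hF)|apply: (diff_upto_at hG)].
Qed.

Lemma diff_uptoM k c W F G : is_chart c -> open W ->
  diff_upto k c W F -> diff_upto k c W G ->
  diff_upto k c W (fun q => F q * G q).
Proof.
move=> hc oW; elim: k F G => [|k IH] F G hF hG.
  by split=> // p dp Wp; apply: diff_atM;
    [apply: (diff_upto_at hF)|apply: (diff_upto_at hG)].
split=> [p dp Wp|i].
  by apply: diff_atM;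
    [apply: (diff_upto_at hF)|apply: (diff_upto_at hG)].
have hF' := diff_uptoW hF; have hG' := diff_uptoW hG.
apply: (diff_upto_ext hc oW _
  (diff_uptoD hc oW (IH _ _ (hF.2 i) hG') (IH _ _ hF' (hG.2 i)))) => q dq Wq.
by rewrite pdM //;
    [apply: (diff_upto_at hF)|apply: (diff_upto_at hG)].
Qed.

Lemma diff_uptoN k c W F : is_chart c -> open W ->
  diff_upto k c W F -> diff_upto k c W (fun q => - F q).
Proof.
move=> hc oW hF.
apply: (diff_upto_ext hc oW _ (diff_uptoM hc oW (diff_upto_cst k (-1) hc oW) hF)).
by move=> q _ _; rewrite mulN1r.
Qed.

(** The derivative of [1/F] is a product of a derivative of [F] with [1/F] itself, so the induction
    on the order runs with [F] fixed. *)
Lemma diff_uptoV k c W F : is_chart c -> open W ->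
  (forall p, cdom c p -> W p -> F p != 0) ->
  diff_upto k c W F -> diff_upto k c W (fun q => (F q)^-1).
Proof.
move=> hc oW F0; elim: k => [|k IH] hF.
  by split=> // p dp Wp; apply: diff_atV => //;
    [exact: F0|apply: (diff_upto_at hF)].
split=> [p dp Wp|i].
  by apply: diff_atV => //;
    [exact: F0|apply: (diff_upto_at hF)].
have hV := IH (diff_uptoW hF).
apply: (diff_upto_ext hc oW _ (diff_uptoN hc oW
  (diff_uptoM hc oW (hF.2 i) (diff_uptoM hc oW hV hV)))) => q dq Wq.
by rewrite pdV //; [exact: F0|apply: (diff_upto_at hF)].
Qed.

Lemma diff_upto_sqrt k c W F : is_chart c -> open W ->
  (forall p, cdom c p -> W p -> 0 < F p) ->
  diff_upto k c W F -> diff_upto k c W (fun q => Num.sqrt (F q)).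
Proof.
move=> hc oW F0; elim: k => [|k IH] hF.
  by split=> // p dp Wp; apply: diff_at_sqrt => //;
    [exact: F0|apply: (diff_upto_at hF)].
split=> [p dp Wp|i].
  by apply: diff_at_sqrt => //;
    [exact: F0|apply: (diff_upto_at hF)].
have hS : diff_upto k c W (fun q => (2 * Num.sqrt (F q))^-1).
  apply: (diff_uptoV hc oW).
    by move=> p dp Wp; rewrite mulf_neq0 ?pnatr_eq0 // gt_eqF ?sqrtr_gt0 ?F0.
  exact: (diff_uptoM hc oW (diff_upto_cst k 2 hc oW) (IH (diff_uptoW hF))).
apply: (diff_upto_ext hc oW _ (diff_uptoM hc oW (hF.2 i) hS)) => q dq Wq.
by rewrite pd_sqrt //; [exact: F0|apply: (diff_upto_at hF)].
Qed.

Lemma csmooth_at c W F p : csmooth c W F -> cdom c p -> W p -> diff_at c F p.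
Proof. by move=> h; apply: (diff_upto_at (h 0)). Qed.

Lemma csmooth_pd c W F i : csmooth c W F -> csmooth c W (pd c i F).
Proof. by move=> h k; exact: (h k.+1).2. Qed.

Lemma csmooth_ext c W F G : is_chart c -> open W ->
  (forall q, cdom c q -> W q -> F q = G q) -> csmooth c W F -> csmooth c W G.
Proof. by move=> hc oW FG h k; exact: diff_upto_ext hc oW FG (h k). Qed.

Lemma csmooth_cst c W a : is_chart c -> open W -> csmooth c W (fun=> a).
Proof. by move=> hc oW k; apply: diff_upto_cst. Qed.

Lemma csmoothD c W F G : is_chart c -> open W ->
  csmooth c W F -> csmooth c W G -> csmooth c W (fun q => F q + G q).
Proof. by move=> hc oW hF hG k; apply: diff_uptoD. Qed.

Lemma csmoothN c W F : is_chart c -> open W ->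
  csmooth c W F -> csmooth c W (fun q => - F q).
Proof. by move=> hc oW hF k; apply: diff_uptoN. Qed.

Lemma csmoothM c W F G : is_chart c -> open W ->
  csmooth c W F -> csmooth c W G -> csmooth c W (fun q => F q * G q).
Proof. by move=> hc oW hF hG k; apply: diff_uptoM. Qed.

Lemma csmoothV c W F : is_chart c -> open W ->
  (forall p, cdom c p -> W p -> F p != 0) ->
  csmooth c W F -> csmooth c W (fun q => (F q)^-1).
Proof. by move=> hc oW F0 hF k; apply: diff_uptoV. Qed.

Lemma csmooth_sqrt c W F : is_chart c -> open W ->
  (forall p, cdom c p -> W p -> 0 < F p) ->
  csmooth c W F -> csmooth c W (fun q => Num.sqrt (F q)).
Proof. by move=> hc oW F0 hF k; apply: diff_upto_sqrt. Qed.

Lemma csmooth_sum c W (I : Type) (r : seq I) (P : pred I) (F : I -> M -> R) :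
  is_chart c -> open W -> (forall i, P i -> csmooth c W (F i)) ->
  csmooth c W (fun q => \sum_(i <- r | P i) F i q).
Proof.
move=> hc oW hF; elim: r => [|j r IH].
  apply: (csmooth_ext hc oW _ (csmooth_cst 0 hc oW)) => q _ _.
  by rewrite big_nil.
case Pj: (P j); last first.
  by apply: (csmooth_ext hc oW _ IH) => q _ _; rewrite big_cons Pj.
apply: (csmooth_ext hc oW _ (csmoothD hc oW (hF j Pj) IH)) => q _ _.
by rewrite big_cons Pj.
Qed.

Lemma csmooth_prod c W (I : Type) (r : seq I) (F : I -> M -> R) :
  is_chart c -> open W -> (forall i, csmooth c W (F i)) ->
  csmooth c W (fun q => \prod_(i <- r) F i q).
Proof.
move=> hc oW hF; elim: r => [|j r IH].
  apply: (csmooth_ext hc oW _ (csmooth_cst 1 hc oW)) => q _ _.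
  by rewrite big_nil.
apply: (csmooth_ext hc oW _ (csmoothM hc oW (hF j) IH)) => q _ _.
by rewrite big_cons.
Qed.

Lemma csmooth_det c W m (A : M -> 'M[R]_m) : is_chart c -> open W ->
  (forall i j, csmooth c W (fun q => A q i j)) ->
  csmooth c W (fun q => \det (A q)).
Proof.
move=> hc oW hA; apply: csmooth_sum => // s _; apply: csmoothM => //.
  exact: csmooth_cst.
exact: csmooth_prod.
Qed.

Lemma csmooth_mulmx c W m1 m2 m3 (A : M -> 'M[R]_(m1, m2))
    (B : M -> 'M[R]_(m2, m3)) i j : is_chart c -> open W ->
  (forall i j, csmooth c W (fun q => A q i j)) ->
  (forall i j, csmooth c W (fun q => B q i j)) ->
  csmooth c W (fun q => (A q *m B q) i j).
Proof.
move=> hc oW hA hB.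
suff : csmooth c W (fun q => \sum_k A q i k * B q k j).
  by apply: csmooth_ext => // q _ _; rewrite mxE.
by apply: csmooth_sum => // k _; apply: csmoothM.
Qed.

Lemma csmooth_invmx c W m (A : M -> 'M[R]_m) i j : is_chart c -> open W ->
  (forall p, cdom c p -> W p -> A p \in unitmx) ->
  (forall i j, csmooth c W (fun q => A q i j)) ->
  csmooth c W (fun q => invmx (A q) i j).
Proof.
move=> hc oW uA hA.
(* Cramer's rule: entries of the inverse are cofactors divided by the determinant. *)
suff : csmooth c W (fun q => (\det (A q))^-1 *
    ((-1) ^+ (j + i) * \det (row' j (col' i (A q))))).
  apply: csmooth_ext => // q dq Wq.
  by rewrite /invmx uA // [RHS]mxE [X in _ = _ * X]mxE.
apply: csmoothM => //.
  apply: csmoothV => //; last exact: csmooth_det.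
  by move=> p dp Wp; have := uA p dp Wp; rewrite unitmxE unitfE.
apply: csmoothM => //; first exact: csmooth_cst.
apply: csmooth_det => // k l; apply: csmooth_ext (hA (lift j k) (lift i l)) => //.
by move=> q _ _; rewrite !mxE.
Qed.

End SmoothFunctions.

(** * Null coframes at a point *)

Lemma I3_case (P : 'I_3 -> Prop) : P 0 -> P 1 -> P 2 -> forall i, P i.
Proof.
move=> P0 P1 P2 [[|[|[|//]]] hi].
- by rewrite (_ : Ordinal hi = 0) //; apply: val_inj.
- by rewrite (_ : Ordinal hi = 1) //; apply: val_inj.
- by rewrite (_ : Ordinal hi = 2) //; apply: val_inj.
Qed.

Definition cross (R : realType) (a b : 'rV[R]_3) : 'rV[R]_3 :=
  \row_i nth 0 [:: a 0 1 * b 0 2 - a 0 2 * b 0 1;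
                   a 0 2 * b 0 0 - a 0 0 * b 0 2;
                   a 0 0 * b 0 1 - a 0 1 * b 0 0] i.

Lemma crossE (R : realType) (a b : 'rV[R]_3) :
  (cross a b 0 0 = a 0 1 * b 0 2 - a 0 2 * b 0 1) *
  (cross a b 0 1 = a 0 2 * b 0 0 - a 0 0 * b 0 2) *
  (cross a b 0 2 = a 0 0 * b 0 1 - a 0 1 * b 0 0).
Proof. by rewrite /cross !mxE. Qed.

Lemma det3 (R : realType) (A : 'M[R]_3) :
  \det A = A 0 0 * (A 1 1 * A 2 2 - A 1 2 * A 2 1) +
           A 0 1 * (A 1 2 * A 2 0 - A 1 0 * A 2 2) +
           A 0 2 * (A 1 0 * A 2 1 - A 1 1 * A 2 0).
Proof.
have -> : A = \matrix_(i < 3) nth 0 [:: row 0 A; row 1 A; row 2 A] i.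
  by apply/row_matrixP; apply: I3_case; rewrite rowK.
by rewrite det3E !mxE.
Qed.

(** The cofactor identity [aH x bH = det H (a x b) H^-T], with the inverse cleared. *)
Lemma cross_mulmx (R : realType) (H : 'M[R]_3) (a b : 'rV[R]_3) :
  cross (a *m H) (b *m H) *m H^T = \det H *: cross a b.
Proof.
apply/rowP; apply: I3_case;
  by rewrite [LHS]mxE [RHS]mxE sum3E !crossE ![(_ *m _) _ _]mxE !sum3E
    ![_^T _ _]mxE det3; ring.
Qed.

Definition dot (R : realType) (a b : 'rV[R]_3) : R := (a *m b^T) 0 0.

Lemma dotE (R : realType) (a b : 'rV[R]_3) :
  dot a b = a 0 0 * b 0 0 + a 0 1 * b 0 1 + a 0 2 * b 0 2.
Proof. by rewrite /dot mxE sum3E ![_^T _ _]mxE. Qed.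

Lemma scalemxE (R : realType) m k (a : R) (A : 'M[R]_(m, k)) i j :
  (a *: A) i j = a * A i j.
Proof. by rewrite mxE. Qed.

Lemma dotC (R : realType) (a b : 'rV[R]_3) : dot a b = dot b a.
Proof. by rewrite !dotE; ring. Qed.

(** The signature acts on the later computations through this sign: it makes [n] of square [+1] in
    [dotNn], and [sqrt |det g|] smooth. *)
Lemma lorentzian_det (R : realType) (G P : 'M[R]_3) :
  P *m G *m P^T = Defs.minkowski R -> \det G < 0.
Proof.
move=> /(congr1 determinant); rewrite !det_mulmx det_tr => e.
have : \det P ^+ 2 * \det G = -1.
  by rewrite expr2 mulrAC e det3 !mxE /=; ring.
move=> e2; rewrite ltNge; apply/negP => G0.
have : 0 <= \det P ^+ 2 * \det G by rewrite mulr_ge0 // sqr_ge0.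
by rewrite e2 lerNr oppr0 lt_geF.
Qed.

Section NullCoframe.
Context (R : realType) (G : 'M[R]_3) (u v n : 'rV[R]_3).
Hypotheses (Gsym : G^T = G) (Gdet : \det G < 0).
Hypotheses (uu : ip1 G u u = 0) (vv : ip1 G v v = 0) (uv : ip1 G u v = 1).
Hypothesis nE : n = - star2 G (wedge1 u v).

Let H := invmx G.
Let U := u *m H.
Let V := v *m H.
Let N := n *m H.

Lemma metric_unit : G \in unitmx.
Proof. by rewrite unitmxE unitfE lt_eqF. Qed.

Lemma inverse_sym : H^T = H.
Proof. by rewrite /H trmx_inv Gsym. Qed.

Lemma dot_sharpC a b : dot (a *m H) b = dot (b *m H) a.
Proof.
rewrite /dot -[LHS]trace_mx11 -mxtrace_tr !trmx_mul trmxK inverse_sym mulmxA.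
by rewrite trace_mx11.
Qed.

Lemma dotUu : dot U u = 0. Proof. exact: uu. Qed.
Lemma dotVv : dot V v = 0. Proof. exact: vv. Qed.
Lemma dotUv : dot U v = 1. Proof. exact: uv. Qed.
Lemma dotVu : dot V u = 1. Proof. by rewrite dot_sharpC dotUv. Qed.

(** Raising both indices turns [u /\ v] into [U /\ V], and contracting the latter with the volume
    form gives a cross product. *)
Lemma normal_cross : n = - vol_coef G *: cross U V.
Proof.
have E : H *m wedge1 u v *m H^T = wedge1 U V.
  rewrite /wedge1 mulmxBr mulmxBl.
  by rewrite /U /V !trmx_mul !inverse_sym !mulmxA.
rewrite nE scaleNr; congr (- _); apply/rowP; apply: I3_case;
  by rewrite [LHS]mxE [RHS]mxE crossE -/H E !sum3E /vol !det3E
    ![delta_mx _ _ _ _]mxE /= !mxE !big_ord1 !mxE; field.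
Qed.

Lemma dotUn : dot U n = 0.
Proof. by rewrite normal_cross dotE !scalemxE !crossE; ring. Qed.
Lemma dotVn : dot V n = 0.
Proof. by rewrite normal_cross dotE !scalemxE !crossE; ring. Qed.
Lemma dotNu : dot N u = 0. Proof. by rewrite dot_sharpC dotUn. Qed.
Lemma dotNv : dot N v = 0. Proof. by rewrite dot_sharpC dotVn. Qed.

(** By Lagrange's identity the square is [|det G| (det G)^-1 (g(u,u) g(v,v) - g(u,v)^2)], where the
    last factor is [-1] and [det G] is negative. *)
Lemma dotNn : dot N n = 1.
Proof.
rewrite /N {1}normal_cross -scalemxAl -{1}inverse_sym cross_mulmx.
rewrite normal_cross -/U -/V.
have -> : dot (- vol_coef G *: (\det H *: cross u v)) (- vol_coef G *: cross U V)
  = vol_coef G ^+ 2 * \det H * (dot U u * dot V v - dot V u * dot U v).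
  by rewrite !dotE !scalemxE !crossE; ring.
rewrite dotUu dotVv dotVu dotUv mul0r sub0r mul1r.
rewrite sqr_sqrtr ?normr_ge0 // ltr0_norm // mulrN1 -mulNr opprK.
by rewrite /H det_inv divff // lt_eqF.
Qed.

(** Triple product expansion: [u x n] is [- vol (u x (U x V))], and
    [u x (U x V) = (u.V) U - (u.U) V = U]. This puts the equation for [u] in the form
    [nabla u = f (n (x) u - u (x) n)]. *)
Lemma star1_wedge : star1 G u = wedge1 n u.
Proof.
have h1 := dotUu; have h2 := dotVu; rewrite !dotE in h1 h2.
suff cr i : vol_coef G * U 0 i = - cross u n 0 i.
  have wE j k : wedge1 n u j k = n 0 j * u 0 k - u 0 j * n 0 k.
    by rewrite /wedge1 !mxE !big_ord1 !mxE.
  have := cr 0; have := cr 1; have := cr 2; rewrite !crossE => c2 c1 c0.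
  apply/matrixP; apply: I3_case; apply: I3_case;
    rewrite [LHS]mxE wE /vol det3E -/H -/U ![delta_mx _ _ _ _]mxE /=;
    lra.
rewrite normal_cross; move: i; apply: I3_case;
  rewrite !crossE !scalemxE !crossE.
- transitivity (vol_coef G * (U 0 0 * (V 0 0 * u 0 0 + V 0 1 * u 0 1 + V 0 2 * u 0 2)
    - V 0 0 * (U 0 0 * u 0 0 + U 0 1 * u 0 1 + U 0 2 * u 0 2))); last ring.
  by rewrite h1 h2; ring.
- transitivity (vol_coef G * (U 0 1 * (V 0 0 * u 0 0 + V 0 1 * u 0 1 + V 0 2 * u 0 2)
    - V 0 1 * (U 0 0 * u 0 0 + U 0 1 * u 0 1 + U 0 2 * u 0 2))); last ring.
  by rewrite h1 h2; ring.
- transitivity (vol_coef G * (U 0 2 * (V 0 0 * u 0 0 + V 0 1 * u 0 1 + V 0 2 * u 0 2)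
    - V 0 2 * (U 0 0 * u 0 0 + U 0 1 * u 0 1 + U 0 2 * u 0 2))); last ring.
  by rewrite h1 h2; ring.
Qed.

(* The frame dual to [(u, v, n)] is [(V, U, N)]. *)
Lemma frame_resolution : U^T *m v + V^T *m u + N^T *m n = 1%:M.
Proof.
pose A := \matrix_(i < 3) nth 0 [:: V; U; N] i.
pose B := \matrix_(i < 3) nth 0 [:: u; v; n] i.
have AB : A *m B^T = 1%:M.
  have e i j : (A *m B^T) i j = dot (row i A) (row j B).
    rewrite /dot [LHS]mxE [RHS]mxE; apply: eq_bigr => k _.
    by rewrite ![_^T _ _]mxE [row i A _ _]mxE [row j B _ _]mxE.
  apply/matrixP; apply: I3_case; apply: I3_case; rewrite e [RHS]mxE !rowK /=.
  all: rewrite ?dotUu ?dotVv ?dotUv ?dotVu ?dotUn ?dotVn ?dotNu ?dotNv ?dotNn //.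
(* A one-sided inverse of a square matrix is two-sided: duality of the frames becomes
   completeness. *)
have BA := mulmx1C AB.
rewrite -[RHS]trmx1 -BA [RHS]trmx_mul trmxK; apply/matrixP => i j.
have -> : (A^T *m B) i j =
    A 0 i * B 0 j + A 1 i * B 1 j + A 2 i * B 2 j.
  by rewrite mxE sum3E ![A^T _ _]mxE.
have tE (a b : 'rV[R]_3) : (a^T *m b) i j = a 0 i * b 0 j.
  by rewrite mxE big_ord1 mxE.
have addE (X Y : 'M[R]_3) : (X + Y) i j = X i j + Y i j by rewrite mxE.
by rewrite !addE !tE ![A _ _]mxE ![B _ _]mxE /=; ring.
Qed.
End NullCoframe.

(** * Matrix-valued functions and curvature *)

Section MatrixDerivative.
Context (R : realType) (n : nat) (M : topologicalType) (c : chart R n M).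
Hypothesis hc : is_chart c.

Definition mpd m k (i : 'I_n) (A : M -> 'M[R]_(m, k)) (p : M) : 'M[R]_(m, k) :=
  \matrix_(j, l) pd c i (fun q => A q j l) p.

Definition mdiff m k (A : M -> 'M[R]_(m, k)) (p : M) : Prop :=
  forall j l, diff_at c (fun q => A q j l) p.

Lemma mpd_near m k W i (A B : M -> 'M[R]_(m, k)) p : open W -> cdom c p -> W p ->
  (forall q, cdom c q -> W q -> A q = B q) -> mpd i A p = mpd i B p.
Proof.
move=> oW dp Wp AB; apply/matrixP => j l; rewrite !mxE.
by apply: (pd_near _ hc oW) => // q dq Wq; rewrite AB.
Qed.

Lemma mpd_cst m k i (A : 'M[R]_(m, k)) p : mpd i (fun=> A) p = 0.
Proof. by apply/matrixP => j l; rewrite !mxE pd_cst. Qed.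

Lemma mdiffD m k (A B : M -> 'M[R]_(m, k)) p : mdiff A p -> mdiff B p ->
  mdiff (fun q => A q + B q) p.
Proof.
move=> dA dB j l; rewrite (_ : (fun _ => _) = fun q => A q j l + B q j l).
  exact: diff_atD.
by apply/funext => q; rewrite mxE.
Qed.

Lemma mpdD m k i (A B : M -> 'M[R]_(m, k)) p : mdiff A p -> mdiff B p ->
  mpd i (fun q => A q + B q) p = mpd i A p + mpd i B p.
Proof.
move=> dA dB; apply/matrixP => j l; rewrite !mxE -pdD //.
by congr pd; apply/funext => q; rewrite mxE.
Qed.

Lemma mdiffN m k (A : M -> 'M[R]_(m, k)) p : mdiff A p ->
  mdiff (fun q => - A q) p.
Proof.
move=> dA j l; rewrite (_ : (fun _ => _) = fun q => - A q j l).
  exact: diff_atN.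
by apply/funext => q; rewrite mxE.
Qed.

Lemma mpdN m k i (A : M -> 'M[R]_(m, k)) p : mdiff A p ->
  mpd i (fun q => - A q) p = - mpd i A p.
Proof.
move=> dA; apply/matrixP => j l; rewrite !mxE -pdN //.
by congr pd; apply/funext => q; rewrite mxE.
Qed.

Lemma mdiff_tr m k (A : M -> 'M[R]_(m, k)) p : mdiff A p ->
  mdiff (fun q => (A q)^T) p.
Proof.
move=> dA j l; rewrite (_ : (fun _ => _) = fun q => A q l j); first exact: dA.
by apply/funext => q; rewrite mxE.
Qed.

Lemma mpd_tr m k i (A : M -> 'M[R]_(m, k)) p :
  mpd i (fun q => (A q)^T) p = (mpd i A p)^T.
Proof.
apply/matrixP => j l; rewrite !mxE.
by congr pd; apply/funext => q; rewrite mxE.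
Qed.

Lemma mdiffM m k r (A : M -> 'M[R]_(m, k)) (B : M -> 'M[R]_(k, r)) p :
  mdiff A p -> mdiff B p -> mdiff (fun q => A q *m B q) p.
Proof.
move=> dA dB j l; rewrite (_ : (fun _ => _) = fun q => \sum_x A q j x * B q x l).
  by apply: diff_at_sum => x _; apply: diff_atM.
by apply/funext => q; rewrite mxE.
Qed.

Lemma mpdM m k r i (A : M -> 'M[R]_(m, k)) (B : M -> 'M[R]_(k, r)) p :
  cdom c p -> mdiff A p -> mdiff B p ->
  mpd i (fun q => A q *m B q) p = mpd i A p *m B p + A p *m mpd i B p.
Proof.
move=> dp dA dB; apply/matrixP => j l; rewrite !mxE.
rewrite (_ : (fun _ => _) = fun q => \sum_x A q j x * B q x l); last first.
  by apply/funext => q; rewrite mxE.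
rewrite pd_sum => [|x _]; last exact: diff_atM.
rewrite -big_split; apply: eq_bigr => x _ /=.
by rewrite pdM // !mxE.
Qed.

Lemma mdiffZ m k (a : M -> R) (A : M -> 'M[R]_(m, k)) p :
  diff_at c a p -> mdiff A p -> mdiff (fun q => a q *: A q) p.
Proof.
move=> da dA j l; rewrite (_ : (fun _ => _) = fun q => a q * A q j l).
  exact: diff_atM.
by apply/funext => q; rewrite mxE.
Qed.

Lemma mpdZ m k i (a : M -> R) (A : M -> 'M[R]_(m, k)) p :
  cdom c p -> diff_at c a p -> mdiff A p ->
  mpd i (fun q => a q *: A q) p = pd c i a p *: A p + a p *: mpd i A p.
Proof.
move=> dp da dA; apply/matrixP => j l; rewrite !mxE -pdM //.
by congr pd; apply/funext => q; rewrite mxE.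
Qed.

Lemma mdiff_sum m k (I : finType) (A : I -> M -> 'M[R]_(m, k)) p :
  (forall x, mdiff (A x) p) -> mdiff (fun q => \sum_x A x q) p.
Proof.
move=> dA j l; rewrite (_ : (fun _ => _) = fun q => \sum_x A x q j l).
  by apply: diff_at_sum => x _; apply: dA.
by apply/funext => q; rewrite summxE.
Qed.

Lemma mpd_sum m k i (I : finType) (A : I -> M -> 'M[R]_(m, k)) p :
  (forall x, mdiff (A x) p) ->
  mpd i (fun q => \sum_x A x q) p = \sum_x mpd i (A x) p.
Proof.
move=> dA; apply/matrixP => j l; rewrite mxE summxE.
rewrite (_ : (fun _ => _) = fun q => \sum_x A x q j l); last first.
  by apply/funext => q; rewrite summxE.
by rewrite pd_sum => [|x _]; [apply: eq_bigr => x _; rewrite mxE|apply: dA].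
Qed.

Definition msmooth m k (W : set M) (A : M -> 'M[R]_(m, k)) : Prop :=
  forall j l, csmooth c W (fun q => A q j l).

Lemma msmooth_diff m k W (A : M -> 'M[R]_(m, k)) p : msmooth W A ->
  cdom c p -> W p -> mdiff A p.
Proof. by move=> sA dp Wp j l; apply: csmooth_at (sA j l) dp Wp. Qed.

Lemma msmooth_mpd m k W i (A : M -> 'M[R]_(m, k)) : open W ->
  msmooth W A -> msmooth W (mpd i A).
Proof.
move=> oW sA j l; apply: csmooth_ext (csmooth_pd i (sA j l)) => //.
by move=> q _ _; rewrite mxE.
Qed.

Lemma mpd_sym m k W i j (A : M -> 'M[R]_(m, k)) p : open W ->
  msmooth W A -> cdom c p -> W p -> mpd i (mpd j A) p = mpd j (mpd i A) p.
Proof.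
move=> oW sA dp Wp; apply/matrixP => x y; rewrite [LHS]mxE [RHS]mxE.
have E l : (fun q => mpd l A q x y) = pd c l (fun q => A q x y).
  by apply/funext => q; rewrite mxE.
rewrite !E; apply: (pd_sym hc oW) => // [q dq Wq||].
- exact: csmooth_at (sA x y) dq Wq.
- exact: csmooth_at (csmooth_pd i (sA x y)) dp Wp.
- exact: csmooth_at (csmooth_pd j (sA x y)) dp Wp.
Qed.

End MatrixDerivative.

Section Curvature.
Context (R : realType) (n : nat) (M : manifold R n) (D : symbols M).

Definition christoffel (c : chart R n M) (i : 'I_n) (p : M) : 'M[R]_n :=
  \matrix_(j, k) D c p i j k.

(** The Christoffel matrices act on row vectors from the right, hence the products stand in the
    order opposite to that of the commutator of derivatives. *)
Definition riemann (c : chart R n M) (i j : 'I_n) (p : M) : 'M[R]_n :=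
  mpd c i (christoffel c j) p - mpd c j (christoffel c i) p +
  christoffel c j p *m christoffel c i p - christoffel c i p *m christoffel c j p.

Lemma riemannE c i j p k l : riemann c i j p k l = curvature D c p i j k l.
Proof.
have E a : (fun q => christoffel c a q k l) = (fun q => D c q a k l).
  by apply/funext => q; rewrite mxE.
rewrite /curvature /riemann !mxE !E -addrA; congr (_ + _).
by rewrite -sumrB; apply: eq_bigr => m _; rewrite !mxE; ring.
Qed.

End Curvature.

Lemma trmxD (V : zmodType) m n (A B : 'M[V]_(m, n)) : (A + B)^T = A^T + B^T.
Proof. by apply/matrixP => i j; rewrite !mxE. Qed.

Lemma trmxN (V : zmodType) m n (A : 'M[V]_(m, n)) : (- A)^T = - A^T.
Proof. by apply/matrixP => i j; rewrite !mxE. Qed.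

Lemma trmxB (V : zmodType) m n (A B : 'M[V]_(m, n)) : (A - B)^T = A^T - B^T.
Proof. by apply/matrixP => i j; rewrite !mxE. Qed.

(* The products are abstracted before [ring] is called entrywise, since matrix
   multiplication is not commutative. *)
Ltac matrix_abel :=
  repeat match goal with |- context [@mulmx ?S ?a ?b ?c ?A ?B] =>
    let X := fresh "X" in
    move: (@mulmx S a b c A B) => X end;
  let i := fresh "i" in let j := fresh "j" in
  apply/matrixP => i j; rewrite !mxE; ring.

Ltac mulmx_expand :=
  rewrite ?(trmxB, trmxD, trmx_mul, trmxN, mulmxBl, mulmxBr, mulmxDl, mulmxDr,
    mulNmx, mulmxN, mulmxA).

(** * Ricci and Bianchi identities, symmetries of the curvature *)

Section RicciIdentities.
Context (R : realType) (n : nat) (M : manifold R n) (D : symbols M).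
Context (c : chart R n M) (p : M).
Hypotheses (ca : atlas M c) (dp : cdom c p).
Hypothesis sD : forall c i j k, atlas M c -> csmooth c setT (fun p => D c p i j k).

Let hc : is_chart c. Proof. exact: manifold_chart ca. Qed.
Let oT : open [set: M]. Proof. exact: openT. Qed.

Lemma christoffel_smooth a : msmooth c setT (christoffel D c a).
Proof.
move=> i j; apply: csmooth_ext (sD a i j ca) => //.
by move=> q _ _; rewrite mxE.
Qed.

Lemma mdiff_christoffel a : mdiff c (christoffel D c a) p.
Proof. exact: msmooth_diff (christoffel_smooth a) _ _. Qed.

Definition nabla (a : 'I_n) (al : M -> 'rV[R]_n) (q : M) : 'rV[R]_n :=
  mpd c a al q - al q *m (christoffel D c a q)^T.

(** Here [b] in [nabla b al] is a mere label, so these are iterated derivatives along coordinate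
    fields. The fields commute, and the commutator is the curvature in its dual action on forms. *)
Lemma ricci_form a b (al : M -> 'rV[R]_n) : msmooth c setT al ->
  nabla a (nabla b al) p - nabla b (nabla a al) p =
  - (al p *m (riemann D c a b p)^T).
Proof.
move=> sal; have dal := msmooth_diff sal dp I.
have E x y : mpd c x (nabla y al) p = mpd c x (mpd c y al) p -
    (mpd c x al p *m (christoffel D c y p)^T +
     al p *m (mpd c x (christoffel D c y) p)^T).
  have dG := mdiff_tr (mdiff_christoffel y).
  rewrite /nabla (mpdD _ (msmooth_diff (msmooth_mpd hc y oT sal) dp I)).
    by rewrite (mpdN _ (mdiffM dal dG)) (mpdM hc _ dp dal dG) mpd_tr.
  exact: mdiffN (mdiffM dal dG).
rewrite /(nabla a) /(nabla b) !E (mpd_sym hc a b oT sal dp I) /riemann.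
rewrite /nabla.
move: (mpd c a (mpd c b al) p) (mpd c a al p) (mpd c b al p) (al p) => X Xa Xb Y.
move: (mpd c a _ p) (mpd c b _ p) (christoffel D c a p) (christoffel D c b p).
by move=> dB dA A B; mulmx_expand; matrix_abel.
Qed.

Lemma riemann_anti a b : riemann D c a b p = - riemann D c b a p.
Proof.
rewrite /riemann.
move: (mpd c a _ p) (mpd c b _ p) (christoffel D c a p) (christoffel D c b p).
by move=> dB dA A B; matrix_abel.
Qed.

Context (g : chart R n M -> M -> 'M[R]_n).
Hypothesis sg : forall i j, csmooth c setT (fun p => g c p i j).
Hypothesis mD : metric_connection g D.

Lemma mpd_metric a q : cdom c q -> mpd c a (g c) q =
  christoffel D c a q *m g c q + g c q *m (christoffel D c a q)^T.
Proof.
move=> dq; apply/matrixP => j k; rewrite !mxE mD // -big_split.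
by apply: eq_bigr => l _; rewrite /= !mxE [X in _ + X]mulrC.
Qed.

(** The mixed second derivatives of [g] commute, and metricity rewrites each of them through the
    Christoffel matrices; the difference of the two orders is the claim. *)
Lemma riemann_skew a b :
  riemann D c a b p *m g c p + g c p *m (riemann D c a b p)^T = 0.
Proof.
have dg : mdiff c (g c) p by move=> i j; apply: csmooth_at (sg i j) dp I.
have E x y : mpd c x (mpd c y (g c)) p =
    (mpd c x (christoffel D c y) p *m g c p +
     christoffel D c y p *m mpd c x (g c) p) +
    (mpd c x (g c) p *m (christoffel D c y p)^T +
     g c p *m (mpd c x (christoffel D c y) p)^T).
  have dG := mdiff_christoffel y; have dGt := mdiff_tr dG.
  rewrite (mpd_near hc x oT dp I (fun q dq _ => mpd_metric y dq)).
  rewrite mpdD ?mpdM ?mpd_tr //; exact: mdiffM.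
have := mpd_sym hc a b oT (sg : msmooth c setT (g c)) dp I.
rewrite !E !mpd_metric // => /eqP; rewrite -subr_eq0 => /eqP <-.
rewrite /riemann; move: (g c p) => G.
move: (mpd c a _ p) (mpd c b _ p) (christoffel D c a p) (christoffel D c b p).
by move=> dB dA A B; mulmx_expand; matrix_abel.
Qed.

Hypothesis tf : torsion_free D.

Lemma pd_torsion_free a i j k :
  pd c a (fun q => D c q i j k) p = pd c a (fun q => D c q j i k) p.
Proof.
by apply: (pd_near _ hc oT) => // q dq _; apply: tf.
Qed.

Lemma bianchi a b k l : curvature D c p a b k l + curvature D c p b k a l +
  curvature D c p k a b l = 0.
Proof.
rewrite /curvature (pd_torsion_free a b k) (pd_torsion_free b k a).
rewrite (pd_torsion_free k a b).
set S1 := \sum_m _; set S2 := \sum_m _; set S3 := \sum_m _.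
have S0 : S1 + S2 + S3 = 0.
  rewrite -!big_split big1 // => m _ /=.
  by rewrite (tf b k m) // (tf a k m) // (tf a b m) //; ring.
by rewrite -[RHS]S0; ring.
Qed.

(** The classical octahedron argument: four cyclic instances of the Bianchi identity, combined
    linearly with the two skew symmetries. *)
Lemma pair_symmetry (Q : 'I_n -> 'I_n -> 'I_n -> 'I_n -> R) :
  (forall a b k l, Q a b k l = - Q b a k l) ->
  (forall a b k l, Q a b k l = - Q a b l k) ->
  (forall a b k l, Q a b k l + Q b k a l + Q k a b l = 0) ->
  forall a b k l, Q a b k l = Q k l a b.
Proof.
move=> s1 s2 B a b k l.
have := B a b k l; have := B b k l a; have := B k l a b; have := B l a b k.
have := s1 a b k l; have := s2 a b k l; have := s1 k l a b; have := s2 k l a b.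
have := s1 b k a l; have := s2 b k a l; have := s1 k a b l; have := s2 k a b l.
have := s1 k l b a; have := s2 b k l a; have := s1 l b k a; have := s2 l b k a.
have := s1 l a k b; have := s2 l a k b; have := s1 a k l b; have := s2 a k l b.
have := s1 a b l k; have := s2 l a b k; have := s1 b l a k; have := s2 b l a k.
lra.
Qed.

Hypothesis gsym : (g c p)^T = g c p.

Lemma riemann_pair a b k l :
  (riemann D c a b p *m g c p) k l = (riemann D c k l p *m g c p) a b.
Proof.
pose Q a b k l := (riemann D c a b p *m g c p) k l; rewrite -!/(Q _ _ _ _).
apply: (pair_symmetry (Q := Q)) => {a b k l} a b k l; rewrite /Q.
- by rewrite riemann_anti mulNmx mxE.
- have -> : (riemann D c a b p *m g c p) l k =
      (g c p *m (riemann D c a b p)^T) k l.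
    by rewrite -{2}gsym -trmx_mul [RHS]mxE.
  by have /eqP := riemann_skew a b; rewrite addr_eq0 => /eqP ->; rewrite mxE.
- rewrite !mxE -!big_split big1 // => m _ /=.
  by rewrite !riemannE -!mulrDl bianchi mul0r.
Qed.

End RicciIdentities.

(** * Skew-torsion Lorentzian three-manifolds *)

Section SkewTorsion.
Context (R : realType) (M : manifold R 3) (g : chart R 3 M -> M -> 'M[R]_3).
Context (D : symbols M) (u v n : chart R 3 M -> M -> 'rV[R]_3) (f : M -> R).
Hypotheses (hg : lorentzian_metric g) (hD : levi_civita g D).
Hypotheses (hf : smooth_function f) (hu : one_form u).
Hypothesis hiso : forall c p, atlas M c -> cdom c p ->
  ip1 (g c p) (u c p) (u c p) = 0.
Hypothesis heq : forall c p, atlas M c -> cdom c p ->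
  covariant_derivative D u c p = f p *: star1 (g c p) (u c p).
Hypothesis hvn : null_coframe g u v n.
Context (c : chart R 3 M).
Hypothesis ca : atlas M c.

Let hc : is_chart c. Proof. exact: manifold_chart ca. Qed.
Let oT : open [set: M]. Proof. exact: openT. Qed.
Let ss : forall c i j k, atlas M c -> csmooth c setT (fun p => D c p i j k).
Proof. by case: hD => -[]. Qed.
Let tfD : torsion_free D. Proof. by case: hD. Qed.
Let mD : metric_connection g D. Proof. by case: hD. Qed.

Lemma metric_smooth : msmooth c setT (g c).
Proof. by case: hg => h _ _ _ i j; exact: h. Qed.

Lemma metric_sym q : cdom c q -> (g c q)^T = g c q.
Proof. by case: hg => _ _ h _; exact: h. Qed.

Lemma metric_det q : cdom c q -> \det (g c q) < 0.
Proof.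
by case: hg => _ _ _ h dq; have [P _] := h c q ca dq; exact: lorentzian_det.
Qed.

Lemma metric_in_unitmx q : cdom c q -> g c q \in unitmx.
Proof. by move=> dq; apply: metric_unit; exact: metric_det. Qed.

Lemma inverse_metric_smooth : msmooth c setT (fun q => invmx (g c q)).
Proof.
move=> i j; apply: csmooth_invmx => //; first by move=> q dq _; exact: metric_in_unitmx.
exact: metric_smooth.
Qed.

Lemma form_smooth (al : chart R 3 M -> M -> 'rV[R]_3) :
  one_form al -> msmooth c setT (al c).
Proof. by case=> h _ i j; rewrite (ord1 i); exact: h. Qed.

Let su : msmooth c setT (u c). Proof. exact: form_smooth. Qed.
Let sv : msmooth c setT (v c). Proof. by apply: form_smooth; case: hvn. Qed.

Lemma star1_at q : cdom c q ->
  star1 (g c q) (u c q) = wedge1 (n c q) (u c q).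
Proof.
move=> dq; exact: star1_wedge (metric_sym dq) (hiso ca dq)
  (nc_conjugate hvn ca dq) (nc_normal hvn ca dq).
Qed.

Lemma dotNn_at q : cdom c q -> dot (n c q *m invmx (g c q)) (n c q) = 1.
Proof.
move=> dq; exact: dotNn (metric_sym dq) (metric_det dq) (hiso ca dq)
  (nc_isotropic hvn ca dq) (nc_conjugate hvn ca dq) (nc_normal hvn ca dq).
Qed.

Lemma dotNu_at q : cdom c q -> dot (n c q *m invmx (g c q)) (u c q) = 0.
Proof.
by move=> dq; exact: dotNu (metric_sym dq) (nc_normal hvn ca dq).
Qed.

Lemma resolution_at q (H := invmx (g c q)) : cdom c q ->
  (u c q *m H)^T *m v c q + (v c q *m H)^T *m u c q + (n c q *m H)^T *m n c q
  = 1%:M.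
Proof.
move=> dq; exact: frame_resolution (metric_sym dq) (metric_det dq) (hiso ca dq)
  (nc_isotropic hvn ca dq) (nc_conjugate hvn ca dq) (nc_normal hvn ca dq).
Qed.

(** [null_coframe] describes [n] only pointwise, through the Hodge star. Smoothness comes from the
    cross product formula, in which [|det g| = - det g] is positive, so that its root is smooth. *)
Lemma normal_smooth : msmooth c setT (n c).
Proof.
move=> i j; rewrite (ord1 i) {i}.
have sU : msmooth c setT (fun q => u c q *m invmx (g c q)).
  by move=> *; apply: csmooth_mulmx => //; exact: inverse_metric_smooth.
have sV : msmooth c setT (fun q => v c q *m invmx (g c q)).
  by move=> *; apply: csmooth_mulmx => //; exact: inverse_metric_smooth.
suff : csmooth c setT (fun q => - Num.sqrt (- \det (g c q)) *
    cross (u c q *m invmx (g c q)) (v c q *m invmx (g c q)) 0 j).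
  apply: csmooth_ext => // q dq _.
  rewrite (normal_cross (metric_sym dq) (nc_normal hvn ca dq)).
  by rewrite scalemxE /vol_coef ltr0_norm //; exact: metric_det.
apply: csmoothM => //.
  apply: csmoothN => //; apply: csmooth_sqrt => //.
    by move=> q dq _; rewrite oppr_gt0; exact: metric_det.
  by apply: csmoothN => //; apply: csmooth_det => //; exact: metric_smooth.
have prod i k l m : csmooth c setT (fun q =>
    (u c q *m invmx (g c q)) 0 i * (v c q *m invmx (g c q)) 0 k -
    (u c q *m invmx (g c q)) 0 l * (v c q *m invmx (g c q)) 0 m).
  by apply: csmoothD => //; [|apply: csmoothN => //]; apply: csmoothM.
move: j; apply: I3_case.
- by apply: csmooth_ext (prod 1 2 2 1) => // q _ _; rewrite crossE.
- by apply: csmooth_ext (prod 2 0 0 2) => // q _ _; rewrite crossE.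
- by apply: csmooth_ext (prod 0 1 1 0) => // q _ _; rewrite crossE.
Qed.

Lemma nabla_u a q : cdom c q ->
  nabla D c a (u c) q = f q *: (n c q 0 a *: u c q - u c q 0 a *: n c q).
Proof.
move=> dq.
have -> : nabla D c a (u c) q = row a (covariant_derivative D u c q).
  apply/rowP => j; rewrite !mxE; congr (_ - _).
  by apply: eq_bigr => k _; rewrite !mxE mulrC.
rewrite heq // star1_at //.
apply/rowP => j; rewrite mxE scalemxE [RHS]mxE; congr (_ * _).
by rewrite /wedge1 !mxE !big_ord1 !mxE.
Qed.

(** * The curvature contracted with [u], at a point of a chart *)

Section AtPoint.
Context (p : M).
Hypothesis dp : cdom c p.

Let Ga a := christoffel D c a p.
Let H := invmx (g c p).

Lemma mpd_inverse a : mpd c a (fun q => invmx (g c q)) p =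
  - (H *m Ga a) - (Ga a)^T *m H.
Proof.
have dg := msmooth_diff metric_smooth dp I.
have dH := msmooth_diff inverse_metric_smooth dp I.
have ug := metric_in_unitmx dp.
have : mpd c a (fun q => g c q *m invmx (g c q)) p = 0.
  rewrite -(mpd_cst c a (1%:M : 'M[R]_3) p).
  by apply: (mpd_near hc _ oT) => // q dq _; rewrite mulmxV // metric_in_unitmx.
rewrite mpdM // (mpd_metric ca mD) // -/H -/(Ga a) => /(congr1 (mulmx H)).
rewrite mulmx0 mulmxDr !mulmxA mulVmx // mul1mx => /eqP.
rewrite addrC addr_eq0 => /eqP ->.
rewrite mulmxDr mulmxDl !mulmxA mulVmx // mul1mx.
by rewrite -!mulmxA mulmxV // mulmx1 opprD.
Qed.

Lemma mpd_pairing a (al be : M -> 'rV[R]_3) :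
  msmooth c setT al -> msmooth c setT be ->
  mpd c a (fun q => al q *m invmx (g c q) *m (be q)^T) p =
  nabla D c a al p *m H *m (be p)^T + al p *m H *m (nabla D c a be p)^T.
Proof.
move=> sal sbe; have dal := msmooth_diff sal dp I.
have dbe := msmooth_diff sbe dp I.
have dH := msmooth_diff inverse_metric_smooth dp I.
rewrite mpdM //; [|exact: mdiffM|exact: mdiff_tr].
rewrite mpdM // mpd_tr mpd_inverse /nabla -/H -/(Ga a).
move: (mpd c a al p) (mpd c a be p) (al p) (be p) (Ga a) H => dA dB A B C K.
by rewrite trmxB trmx_mul trmxK; mulmx_expand; matrix_abel.
Qed.

Lemma pd_pairing a (al be : M -> 'rV[R]_3) :
  msmooth c setT al -> msmooth c setT be ->
  pd c a (fun q => dot (al q *m invmx (g c q)) (be q)) p =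
  dot (nabla D c a al p *m H) (be p) + dot (nabla D c a be p *m H) (al p).
Proof.
move=> sal sbe; have /matrixP/(_ 0 0) := mpd_pairing a sal sbe.
rewrite mxE [RHS]mxE => ->; congr (_ + _).
by rewrite (dot_sharpC (metric_sym dp)).
Qed.

(** The coefficient [k] can stay unspecified: it cancels in [rhoE]. *)
Lemma nabla_n a : exists k,
  nabla D c a (n c) p = (f p * u c p 0 a) *: v c p + k *: u c p.
Proof.
have sn := normal_smooth; set Z := nabla D c a (n c) p.
have e1 : dot (Z *m H) (n c p) = 0.
  have : pd c a (fun q => dot (n c q *m invmx (g c q)) (n c q)) p = 0.
    rewrite -(pd_cst c a 1 p); apply: (pd_near _ hc oT) => // q dq _.
    exact: dotNn_at.
  by rewrite pd_pairing // -/Z -mulr2n => /eqP; rewrite mulrn_eq0 => /eqP.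
have e2 : dot (Z *m H) (u c p) = f p * u c p 0 a.
  have : pd c a (fun q => dot (n c q *m invmx (g c q)) (u c q)) p = 0.
    rewrite -(pd_cst c a 0 p); apply: (pd_near _ hc oT) => // q dq _.
    exact: dotNu_at.
  rewrite pd_pairing // -/Z nabla_u // => /eqP; rewrite addr_eq0 => /eqP ->.
  rewrite -scalemxAl mulmxBl -!scalemxAl.
  have -> (x y z : R) (A B : 'rV[R]_3) : dot (x *: (y *: A - z *: B)) (n c p) =
      x * (y * dot A (n c p) - z * dot B (n c p)).
    by rewrite !dotE !mxE; ring.
  rewrite (dot_sharpC (metric_sym dp) (u c p)) dotNu_at // dotNn_at //; ring.
(* Resolving the identity in the null frame gives [Z = g(Z,u) v + g(Z,v) u + g(Z,n) n]. *)
exists (dot (Z *m H) (v c p)).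
have tE (A B : 'rV[R]_3) : Z *m (A *m H)^T *m B = dot (Z *m H) A *: B.
  rewrite trmx_mul (inverse_sym (metric_sym dp)) !mulmxA.
  by rewrite [X in X *m _]mx11_scalar mul_scalar_mx.
rewrite -[LHS]mulmx1 -(resolution_at dp) -/H !mulmxDr !mulmxA !tE e1 e2.
by rewrite scale0r addr0.
Qed.

Lemma nabla_nabla_u a b :
  nabla D c a (nabla D c b (u c)) p =
  pd c a f p *: (n c p 0 b *: u c p - u c p 0 b *: n c p) +
  f p *: (pd c a (fun q => n c q 0 b) p *: u c p -
          pd c a (fun q => u c q 0 b) p *: n c p +
          n c p 0 b *: nabla D c a (u c) p - u c p 0 b *: nabla D c a (n c) p).
Proof.
have du := msmooth_diff su dp I; have dn := msmooth_diff normal_smooth dp I.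
have df : diff_at c f p by apply: csmooth_at (hf ca) dp I.
have dnu := mdiffZ (dn 0 b) du; have dun := mdiffZ (du 0 b) dn.
have dun' := mdiffN dun; have dW := mdiffD dnu dun'.
rewrite {1}/nabla nabla_u //.
rewrite (mpd_near hc a oT dp I (fun q dq _ => nabla_u b dq)).
rewrite (mpdZ hc _ dp df dW) (mpdD _ dnu dun') (mpdN _ dun).
rewrite (mpdZ hc _ dp (dn 0 b) du) (mpdZ hc _ dp (du 0 b) dn) /nabla.
rewrite -!scalemxAl mulmxBl -!scalemxAl.
move: (u c p *m _) (n c p *m _) => x y; apply/rowP => j.
by rewrite !mxE; ring.
Qed.

(** Torsion-freeness expresses the exterior derivative through [nabla]. It removes the coordinate
    derivatives of the components of [u] and [n] left by [nabla_nabla_u], which occur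
    antisymmetrized in the Ricci identity. *)
Lemma pd_anti (al : M -> 'rV[R]_3) a b :
  pd c a (fun q => al q 0 b) p - pd c b (fun q => al q 0 a) p =
  nabla D c a al p 0 b - nabla D c b al p 0 a.
Proof.
have E x y : nabla D c x al p 0 y =
    pd c x (fun q => al q 0 y) p - \sum_k al p 0 k * D c p x y k.
  by rewrite !mxE; congr (_ - _); apply: eq_bigr => k _; rewrite !mxE.
rewrite !E; have -> : \sum_k al p 0 k * D c p b a k = \sum_k al p 0 k * D c p a b k.
  by apply: eq_bigr => k _; rewrite (tfD b a).
ring.
Qed.

(** With the last index lowered, this is [g(R(d_a, d_b) d_k, u^#)]. *)
Definition rho a b k : R := (u c p *m (riemann D c a b p)^T) 0 k.

Lemma rhoE a b k (U := u c p 0) (V := v c p 0) (N := n c p 0)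
    (F := fun i => pd c i f p) :
  rho a b k = - (F a * (N b * U k - U b * N k) - F b * (N a * U k - U a * N k) +
    f p ^+ 2 * ((U a * V b - U b * V a) * U k + (N b * U a - N a * U b) * N k)).
Proof.
have /(congr1 -%R) := ricci_form ca dp ss a b su.
rewrite opprK => /rowP/(_ k); rewrite -/(rho a b k) => <-.
rewrite !nabla_nabla_u.
have nu x y : nabla D c x (u c) p 0 y = f p * (N x * U y - U x * N y).
  by rewrite nabla_u // /N /U !mxE.
(* [ka] and [kb] enter twice, through the exterior derivative of [n] and through [nabla n] itself,
   with opposite signs. *)
have [ka na] := nabla_n a; have [kb nb] := nabla_n b.
have nna y : nabla D c a (n c) p 0 y = f p * U a * V y + ka * U y.
  by rewrite na /U /V !mxE.
have nnb y : nabla D c b (n c) p 0 y = f p * U b * V y + kb * U y.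
  by rewrite nb /U /V !mxE.
have un : pd c a (fun q => u c q 0 b) p - pd c b (fun q => u c q 0 a) p =
    f p * (N a * U b - U a * N b) - f p * (N b * U a - U b * N a).
  by rewrite pd_anti !nu.
have nn : pd c a (fun q => n c q 0 b) p - pd c b (fun q => n c q 0 a) p =
    f p * U a * V b + ka * U b - (f p * U b * V a + kb * U a).
  by rewrite pd_anti nna nnb.
move: un nn.
have := nu a k; have := nu b k; have := nna k; have := nnb k.
move: (nabla D c a (n c) p) (nabla D c b (n c) p) (nabla D c a (u c) p)
  (nabla D c b (u c) p) => Xa Xb Ya Yb.
rewrite -/(F a) -/(F b); move: (F a) (F b) => Fa Fb.
move: (pd c a _ p) (pd c b _ p) (pd c a _ p) (pd c b _ p) => da db da' db'.
move=> e1 e2 e3 e4 eu en; rewrite !mxE e1 e2 e3 e4 -/(U k) -/(N k) -/(U a).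
rewrite -/(U b) -/(N a) -/(N b).
move: eu en => /eqP; rewrite subr_eq => /eqP -> /eqP; rewrite subr_eq => /eqP ->.
ring.
Qed.

Lemma rho_bianchi a b k : rho a b k + rho b k a + rho k a b = 0.
Proof.
rewrite /rho !mxE -!big_split big1 // => l _ /=.
by rewrite ![(riemann _ _ _ _ _)^T _ _]mxE !riemannE -!mulrDr bianchi ?mulr0.
Qed.

(** The entries of [star1] are the components of [u^#] scaled by the volume coefficient; [star1_at]
    equates them with minors of [n] and [u]. *)
Lemma sharp_u_cross (U := u c p *m H) (s := vol_coef (g c p)) :
  s *: U = cross (n c p) (u c p).
Proof.
have E i j : star1 (g c p) (u c p) i j =
    n c p 0 i * u c p 0 j - u c p 0 i * n c p 0 j.
  by rewrite star1_at // /wedge1 !mxE !big_ord1 !mxE.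
have := E 0 1; have := E 1 2; have := E 2 0.
rewrite ![star1 _ _ _ _]mxE /vol !det3E /sharp -/H -/U.
rewrite ![delta_mx _ _ _ _]mxE /= => e1 e2 e3.
by apply/rowP; apply: I3_case; rewrite scalemxE crossE /s; lra.
Qed.

Lemma vol_coef_neq0 : vol_coef (g c p) != 0.
Proof.
by rewrite /vol_coef gt_eqF // sqrtr_gt0 normr_gt0 lt_eqF // metric_det.
Qed.

(* The Bianchi identity for [rho] reads [df /\ n /\ u = 0]. *)
Lemma differential_u : dot (u c p *m H) (differential f c p) = 0.
Proof.
apply: (mulfI vol_coef_neq0); rewrite mulr0.
have dZ (x : R) (A B : 'rV[R]_3) : x * dot A B = dot (x *: A) B.
  by rewrite !dotE !scalemxE; ring.
rewrite dZ sharp_u_cross dotE !crossE ![differential _ _ _ _ _]mxE.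
(* The cyclic sum is [- 2 det(df, n, u)]: the terms in [f^2] form determinants with a repeated
   row. *)
by have := rho_bianchi 0 1 2; rewrite !rhoE; lra.
Qed.

Hypothesis flat_n :
  dot (n c p *m H) (differential f c p) + f p ^+ 2 = 0.

(** As [df(u) = 0], one has [df = df(v) u + df(n) n], and [l] is [df(v)]. In [rhoE] the coefficient
    of [n_k] becomes [- (df(n) + f^2) (u_a n_b - u_b n_a)], which is exactly what [flat_n] kills. *)
Lemma rho_flat : exists l, forall a b k,
  rho a b k = - (l * (u c p 0 a * n c p 0 b - u c p 0 b * n c p 0 a) +
    f p ^+ 2 * (u c p 0 a * v c p 0 b - u c p 0 b * v c p 0 a)) * u c p 0 k.
Proof.
exists (dot (v c p *m H) (differential f c p)) => a b k.
set l := dot _ _.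
have dfE i : pd c i f p = l * u c p 0 i - f p ^+ 2 * n c p 0 i.
  have tE (A B : 'rV[R]_3) : differential f c p *m A^T *m B =
      dot A (differential f c p) *: B.
    by rewrite dotC [X in X *m _]mx11_scalar mul_scalar_mx.
  have -> : pd c i f p = differential f c p 0 i by rewrite mxE.
  rewrite -[differential f c p]mulmx1 -(resolution_at dp) -/H.
  rewrite !mulmxDr !mulmxA !tE differential_u -/l.
  have /eqP := flat_n; rewrite addr_eq0 => /eqP ->.
  by rewrite !mxE; ring.
by rewrite rhoE !dfE; ring.
Qed.

Definition riemann2 (X Y : 'rV[R]_3) : 'M[R]_3 :=
  \sum_a \sum_b (X 0 a * Y 0 b) *: riemann D c a b p.

Lemma riemann2_anti X Y : riemann2 X Y = - riemann2 Y X.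
Proof.
rewrite /riemann2 exchange_big -sumrN; apply: eq_bigr => b _.
rewrite -sumrN; apply: eq_bigr => a _ /=.
by rewrite (riemann_anti _ _ _ a b) scalerN mulrC.
Qed.

Lemma riemann2_linear x y X Y Z :
  riemann2 (x *: X + y *: Y) Z = x *: riemann2 X Z + y *: riemann2 Y Z.
Proof.
rewrite /riemann2 !scaler_sumr -big_split; apply: eq_bigr => a _.
rewrite !scaler_sumr -big_split; apply: eq_bigr => b _ /=.
by rewrite !mxE !scalerA -scalerDl; congr (_ *: _); ring.
Qed.

(* By [rho_flat] and the pair symmetry of the curvature. *)
Lemma riemann2_u Z : dot Z (u c p) = 0 -> riemann2 Z (u c p *m H) = 0.
Proof.
move=> Zu; set U := u c p *m H.
have [l rl] := rho_flat.
suff : riemann2 Z U *m g c p = 0.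
  move=> /(congr1 (mulmx^~ H)); rewrite mul0mx -mulmxA mulmxV ?mulmx1 //.
  exact: metric_in_unitmx.
apply/matrixP => a b; rewrite [RHS]mxE.
(* Pair symmetry moves [Z] and [U] to the last two slots. Lowering [U] back to [u] produces
   [rho a b k] summed against [Z_k], a multiple of [u(Z) = 0]. *)
have -> : (riemann2 Z U *m g c p) a b =
    (Z *m (riemann D c a b p *m g c p) *m U^T) 0 0.
  rewrite /riemann2 mulmx_suml summxE.
  under eq_bigr => k _ do rewrite mulmx_suml summxE.
  rewrite exchange_big mxE; apply: eq_bigr => m _.
  rewrite [X in _ = X * _]mxE mulr_suml; apply: eq_bigr => k _ /=.
  rewrite -scalemxAl mxE (riemann_pair ca dp ss metric_smooth mD tfD (metric_sym dp)).
  by rewrite [U^T _ _]mxE mulrAC.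
have gU : g c p *m U^T = (u c p)^T.
  rewrite trmx_mul (inverse_sym (metric_sym dp)) mulmxA mulmxV ?mul1mx //.
  exact: metric_in_unitmx.
rewrite -!mulmxA gU mxE.
have rE k : (riemann D c a b p *m (u c p)^T) k 0 = rho a b k.
  by rewrite /rho -[u c p in RHS]trmxK -trmx_mul [RHS]mxE.
under eq_bigr => k _ do rewrite rE rl mulrCA.
move: Zu; rewrite -mulr_sumr /dot mxE => Zu.
rewrite (eq_bigr (fun k => Z 0 k * (u c p)^T k 0)); first by rewrite Zu mulr0.
by move=> k _; rewrite [(u c p)^T _ _]mxE.
Qed.

(** [u^#] and [n^#] span [ker u], so bilinearity and antisymmetry leave only a multiple of
    [R(n^#, u^#)], which [riemann2_u] annihilates. *)
Lemma riemann2_kernel X Y : dot X (u c p) = 0 -> dot Y (u c p) = 0 ->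
  riemann2 X Y = 0.
Proof.
move=> Xu Yu; set U := u c p *m H; set N := n c p *m H.
have tangent Z : dot Z (u c p) = 0 -> exists x y, Z = x *: U + y *: N.
  move=> Zu; exists (dot Z (v c p)), (dot Z (n c p)).
  have tE (A B : 'rV[R]_3) : Z *m A^T *m B = dot Z A *: B.
    by rewrite [X in X *m _]mx11_scalar mul_scalar_mx.
  rewrite -[LHS]mulmx1 -trmx1 -(resolution_at dp) -/H -/U -/N.
  rewrite !trmxD !(trmx_mul _^T) !trmxK !mulmxDr !mulmxA !tE Zu.
  by rewrite scale0r mul0mx addr0 -!scalemxAl.
have [x [y ->]] := tangent X Xu; have [x' [y' ->]] := tangent Y Yu.
have UU : riemann2 U U = 0 by apply: riemann2_u; exact: hiso.
have NU : riemann2 N U = 0 by apply: riemann2_u; exact: dotNu_at.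
have UN : riemann2 U N = 0 by rewrite riemann2_anti NU oppr0.
have NN : riemann2 N N = 0.
  have := riemann2_anti N N; move: (riemann2 N N) => A hA.
  by apply/matrixP => i j; have /matrixP/(_ i j) := hA; rewrite !mxE; lra.
rewrite riemann2_linear riemann2_anti [riemann2 N _]riemann2_anti.
by rewrite !riemann2_linear UU NU UN NN !(scaler0, addr0, oppr0).
Qed.

End AtPoint.

End SkewTorsion.

(** * Maps between manifolds *)

Section SmoothMaps.
Context (R : realType) (m n : nat) (L : manifold R m) (M : manifold R n).
Context (F : L -> M).
Hypothesis sF : smooth_map F.

Lemma preimage_open (c : chart R n M) : atlas M c -> open (F @^-1` cdom c).
Proof.
move=> ca; have [cF _] := sF; move/continuousP: cF; apply.
by have [] := manifold_chart ca.
Qed.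

Context (b : chart R m L) (c : chart R n M).
Hypotheses (ba : atlas L b) (ca : atlas M c).

Let hb : is_chart b. Proof. exact: manifold_chart ba. Qed.
Let hc : is_chart c. Proof. exact: manifold_chart ca. Qed.
Let W := F @^-1` cdom c.
Let oW : open W. Proof. exact: preimage_open. Qed.

Lemma jac_smooth : msmooth b W (jac F b c).
Proof.
move=> i x; have [_ h] := sF; have := csmooth_pd i (h b c ba ca x).
by apply: csmooth_ext => // q _ _; rewrite mxE.
Qed.

Lemma diff_at_comp h q : cdom b q -> W q -> diff_at c h (F q) ->
  diff_at b (h \o F) q /\
  forall i, pd b i (h \o F) q = \sum_x jac F b c q i x * pd c x h (F q).
Proof.
move=> dq Wq dh; pose phi := cmap c \o F \o cinv b.
have dphix x : differentiable (fun y => phi y 0 x) (cmap b q).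
  by have [_ sFx] := sF; exact: csmooth_at (sFx b c ba ca x) dq Wq.
have dphi : differentiable phi (cmap b q).
  have -> : phi = \sum_x (fun y => phi y 0 x *: delta_mx 0 x).
    apply/funext => y; rewrite {1}[phi y]row_sum_delta.
    by elim/big_rec2: _ => // x a e _ ->.
  by apply: differentiable_sum => x; apply: differentiableZl.
have phiq : phi (cmap b q) = cmap c (F q) by rewrite /phi /= cinvK.
(* Inserting [cinv c] after [cmap c] changes nothing only where [F] lands in the chart [c], hence
   the restriction to a neighbourhood. *)
have nr : {near cmap b q, (h \o cinv c) \o phi =1 (h \o F) \o cinv b}.
  have := chart_near hb oW dq Wq; apply: filterS => y [_ Wy _].
  by rewrite /phi /= cinvK.
have dh' : differentiable (h \o cinv c) (phi (cmap b q)) by rewrite phiq.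
have dcomp := differentiable_comp dphi dh'.
have dF : diff_at b (h \o F) q := near_eq_differentiable nr dcomp.
split=> // i.
have <- : 'D_(delta_mx 0 i) ((h \o cinv c) \o phi) (cmap b q) =
    pd b i (h \o F) q by apply: near_eq_derive.
rewrite (deriveE _ dcomp) (diff_comp dphi dh') /= -(deriveE _ dphi).
rewrite (derive_mx (diff_derivable dphi)) phiq.
rewrite [X in 'd _ _ X]row_sum_delta linear_sum; apply: eq_bigr => x _.
by rewrite linearZ /= -[_ *: _]/(_ * _) -pdE // !mxE.
Qed.

(** By the chain rule, the first derivatives of [h \o F] are sums of Jacobian entries, smooth to all
    orders, times [pd c x h \o F], to which the induction applies. *)
Lemma diff_upto_comp k h : diff_upto k c setT h -> diff_upto k b W (h \o F).
Proof.
elim: k h => [|k IH] h sh.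
  by split=> // q dq Wq; apply: (diff_at_comp dq Wq _).1; apply: diff_upto_at sh _ _.
split=> [q dq Wq|i].
  by apply: (diff_at_comp dq Wq _).1; apply: diff_upto_at sh _ _.
have : diff_upto k b W (fun q => \sum_x jac F b c q i x * (pd c x h \o F) q).
  elim: (index_enum _) => [|x r IHr].
    apply: (diff_upto_ext hb oW _ (diff_upto_cst k 0 hb oW)) => q _ _.
    by rewrite big_nil.
  have sx := diff_uptoM hb oW (jac_smooth i x k) (IH _ (sh.2 x)).
  apply: (diff_upto_ext hb oW _ (diff_uptoD hb oW sx IHr)) => q _ _.
  by rewrite big_cons.
apply: diff_upto_ext => // q dq Wq.
by rewrite (diff_at_comp dq Wq _).2 //; apply: diff_upto_at sh _ _.
Qed.

Lemma csmooth_comp h : csmooth c setT h -> csmooth b W (h \o F).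
Proof. by move=> sh k; apply: diff_upto_comp. Qed.

Lemma mpd_comp r s (A : M -> 'M[R]_(r, s)) i q : cdom b q -> W q ->
  mdiff c A (F q) ->
  mpd b i (A \o F) q = \sum_x jac F b c q i x *: mpd c x A (F q).
Proof.
move=> dq Wq dA; apply/matrixP => j k; rewrite mxE summxE.
rewrite ((diff_at_comp dq Wq (dA j k)).2 i).
by apply: eq_bigr => x _; rewrite [RHS]mxE [mpd _ _ _ _ _ _]mxE.
Qed.

(** The connection matrix of the bundle [F^* TM] in the coordinate frame of [c]. *)
Definition pulled_symbols (D : symbols M) (i : 'I_m) (q : L) : 'M[R]_n :=
  \sum_x jac F b c q i x *: christoffel D c x (F q).

(* Row j holds the components of the pulled back derivative of
   [dF(d/dx^j)] along [d/dx^i]. *)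
Definition pullback (D : symbols M) (i : 'I_m) (q : L) : 'M[R]_(m, n) :=
  mpd b i (jac F b c) q + jac F b c q *m pulled_symbols D i q.

Lemma pullbackE D i q j k : pullback D i q j k = hess F b c q i j k +
  \sum_x \sum_y D c (F q) x y k * jac F b c q i x * jac F b c q j y.
Proof.
rewrite mxE; congr (_ + _).
  by rewrite mxE /hess; congr pd; apply/funext => q'; rewrite mxE.
rewrite mxE exchange_big; apply: eq_bigr => y _.
rewrite /pulled_symbols summxE mulr_sumr; apply: eq_bigr => x _.
by rewrite scalemxE [christoffel _ _ _ _ _ _]mxE; ring.
Qed.

End SmoothMaps.

Lemma id_smooth (R : realType) (n : nat) (M : manifold R n) :
  smooth_map (id : M -> M).
Proof.
split=> [x|b c ba ca j]; first exact: cvg_id.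
exact: manifold_compat ba ca j.
Qed.

(** * Composition law for Jacobians and pulled back derivatives *)

Section Composition.
Context (R : realType) (l m n : nat) (L : manifold R l) (M : manifold R m).
Context (K : manifold R n) (F : L -> M) (G : M -> K).
Hypotheses (sF : smooth_map F) (sG : smooth_map G).
Context (b : chart R l L) (c : chart R m M) (d : chart R n K).
Hypotheses (ba : atlas L b) (ca : atlas M c) (da : atlas K d).
Context (D : symbols M) (D' : symbols K).

Lemma jac_comp q : cdom b q -> cdom c (F q) -> cdom d (G (F q)) ->
  jac (G \o F) b d q = jac F b c q *m jac G c d (F q).
Proof.
move=> dq dFq dGFq; apply/matrixP => i j; rewrite [LHS]mxE [RHS]mxE.
have [_ sGj] := sG; have dh := csmooth_at (sGj c d ca da j) dFq dGFq.
rewrite ((diff_at_comp sF ba ca dq dFq dh).2 i).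
by apply: eq_bigr => x _; rewrite [jac G _ _ _ _ _]mxE.
Qed.

(** The composition law of second fundamental forms: the bracket is the failure of [G] to intertwine
    [D] and [D']. With an identity map as one of the two factors, it gives the behaviour under a
    change of chart in the target or in the source. *)
Lemma pullback_comp i q : cdom b q -> cdom c (F q) -> cdom d (G (F q)) ->
  pullback (G \o F) b d D' i q =
  pullback F b c D i q *m jac G c d (F q) +
  jac F b c q *m \sum_x jac F b c q i x *:
    (pullback G c d D' x (F q) - christoffel D c x (F q) *m jac G c d (F q)).
Proof.
move=> dq dFq dGFq; have hb := manifold_chart ba.
have oF := preimage_open sF ca; have oG := preimage_open sG da.
have oFG : open (F @^-1` (G @^-1` cdom d)).
  by have [/continuousP cF _] := sF; exact: cF.
have dJF := msmooth_diff (jac_smooth sF ba ca) dq dFq.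
have dJG := msmooth_diff (jac_smooth sG ca da) dFq dGFq.
have dJGF : mdiff b (jac G c d \o F) q.
  by move=> r s; exact: (diff_at_comp sF ba ca dq dFq (dJG r s)).1.
have E1 : mpd b i (jac (G \o F) b d) q = mpd b i (jac F b c) q *m jac G c d (F q) +
    jac F b c q *m \sum_x jac F b c q i x *: mpd c x (jac G c d) (F q).
  rewrite (mpd_near hb i (openI oF oFG) dq (conj dFq dGFq)
    (fun q' dq' h => jac_comp dq' h.1 h.2)).
  by rewrite (mpdM hb i dq dJF dJGF) (mpd_comp sF ba ca i dq dFq dJG).
have E2 : pulled_symbols (G \o F) b d D' i q =
    \sum_x jac F b c q i x *: pulled_symbols G c d D' x (F q).
  rewrite /pulled_symbols (jac_comp dq dFq dGFq).
  under eq_bigr => z _ do rewrite mxE scaler_suml.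
  rewrite exchange_big; apply: eq_bigr => x _ /=.
  by rewrite scaler_sumr; apply: eq_bigr => z _; rewrite scalerA.
rewrite {1}/pullback E1 E2 (jac_comp dq dFq dGFq).
under [X in _ = _ + _ *m X]eq_bigr => x _ do
  rewrite /pullback addrAC scalerDr scalerBr.
rewrite big_split /= sumrB mulmxDr mulmxBr.
rewrite /pullback mulmxDl -[jac F b c q *m _ *m jac G c d _]mulmxA.
have -> : pulled_symbols F b c D i q *m jac G c d (F q) =
    \sum_x jac F b c q i x *: (christoffel D c x (F q) *m jac G c d (F q)).
  by rewrite mulmx_suml; apply: eq_bigr => x _; rewrite scalemxAl.
have -> : jac F b c q *m jac G c d (F q) *m
    \sum_x jac F b c q i x *: pulled_symbols G c d D' x (F q) =
  jac F b c q *m \sum_x jac F b c q i x *: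
    (jac G c d (F q) *m pulled_symbols G c d D' x (F q)).
  rewrite -mulmxA mulmx_sumr; congr (_ *m _).
  by apply: eq_bigr => x _; rewrite -scalemxAr.
matrix_abel.
Qed.

End Composition.

Lemma intertwinesP (R : realType) (m n : nat) (L : manifold R m)
    (M : manifold R n) (F : L -> M) (E : symbols L) (D : symbols M) :
  intertwines F E D <->
  forall b c q i, atlas L b -> atlas M c -> cdom b q -> cdom c (F q) ->
    pullback F b c D i q = christoffel E b i q *m jac F b c q.
Proof.
have rE b c q i j k : (christoffel E b i q *m jac F b c q) j k =
    \sum_l E b q i j l * jac F b c q l k.
  by rewrite mxE; apply: eq_bigr => l _; rewrite [christoffel _ _ _ _ _ _]mxE.
split=> [h b c q i ba ca dq dFq|h b c q ba ca dq dFq i j k].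
  by apply/matrixP => j k; rewrite pullbackE rE; exact: h.
by rewrite -pullbackE h.
Qed.

(** * The induced connection on an immersed submanifold *)

(** If [x J J^T = 0], then [x J J^T x^T] vanishes; it is the sum of the squares of the entries of
    [x J]. *)
Lemma gram_unitmx (R : realType) (m n : nat) (J : 'M[R]_(m, n)) :
  row_free J -> J *m J^T \in unitmx.
Proof.
move=> fJ; rewrite -row_free_unit -kermx_eq0; apply/eqP/row_matrixP => i.
rewrite row0; set x := row i _.
have : x *m (J *m J^T) = 0 by apply/sub_kermxP; exact: row_sub.
move=> /(congr1 (mulmx^~ x^T)); rewrite mul0mx mulmxA -mulmxA -trmx_mul => h.
have : x *m J = 0.
  move: (x *m J) h => y /matrixP/(_ 0 0); rewrite !mxE => h.
  apply/rowP => j; rewrite mxE; apply/eqP; rewrite -sqrf_eq0; apply/eqP.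
  move: j (isT); apply: psumr_eq0P => [k _|]; first exact: sqr_ge0.
  by rewrite -[RHS]h; apply: eq_bigr => k _; rewrite mxE expr2.
by move=> /eqP; rewrite mulmx_free_eq0 // => /eqP.
Qed.

(** The Moore-Penrose right inverse. Being rational in the entries of [J], it depends smoothly on
    the point; it uses the Euclidean product of the coordinates, as [g] may degenerate on the
    image. *)
Definition row_inverse (R : realType) (m n : nat) (J : 'M[R]_(m, n)) :
  'M[R]_(n, m) := J^T *m invmx (J *m J^T).

Lemma mulmx_row_inverse (R : realType) (m n : nat) (J : 'M[R]_(m, n)) :
  row_free J -> J *m row_inverse J = 1%:M.
Proof. by move=> fJ; rewrite /row_inverse mulmxA mulmxV // gram_unitmx. Qed.

Section InducedConnection.
Context (R : realType) (m n : nat) (L : manifold R m) (M : manifold R n).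
Context (F : L -> M) (D : symbols M).
Hypotheses (sF : smooth_map F) (hD : connection D).
Hypothesis immersion : forall b c q, atlas L b -> atlas M c -> cdom b q ->
  cdom c (F q) -> row_free (jac F b c q).
Hypothesis tangent : forall b c q i, atlas L b -> atlas M c -> cdom b q ->
  cdom c (F q) -> (pullback F b c D i q <= jac F b c q)%MS.

Definition chart_at (p : M) : chart R n M := s2val (cid2 (manifold_cover p)).

Lemma chart_at_atlas p : atlas M (chart_at p).
Proof. exact: s2valP. Qed.

Lemma chart_at_dom p : cdom (chart_at p) p.
Proof. by rewrite /chart_at; case: (cid2 _). Qed.

(** The chart chosen at [F q] may jump with [q]; [christoffel_induced] shows that every chart around
    [F q] gives the same symbols. *)
Definition induced : symbols L := fun b q i j k =>
  (pullback F b (chart_at (F q)) D i q *m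
   row_inverse (jac F b (chart_at (F q)) q)) j k.

Lemma pullback_chart b c d q i : atlas L b -> atlas M c -> atlas M d ->
  cdom b q -> cdom c (F q) -> cdom d (F q) ->
  pullback F b d D i q = pullback F b c D i q *m trans c d (F q).
Proof.
move=> ba ca da dq dFq dFq'.
have := pullback_comp sF (@id_smooth _ _ M) ba ca da D D i dq dFq dFq'.
rewrite big1 ?mulmx0 ?addr0 // => x _.
have /intertwinesP h := hD.2.
by rewrite (h c d (F q) x) // subrr scaler0.
Qed.

Lemma jac_chart b c d q : atlas L b -> atlas M c -> atlas M d ->
  cdom b q -> cdom c (F q) -> cdom d (F q) ->
  jac F b d q = jac F b c q *m trans c d (F q).
Proof. by move=> *; apply: (jac_comp sF (@id_smooth _ _ M)). Qed.

Lemma induced_intertwines : intertwines F induced D.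
Proof.
apply/intertwinesP => b d q i ba da dq dFq.
have -> : christoffel induced b i q = pullback F b (chart_at (F q)) D i q *m
    row_inverse (jac F b (chart_at (F q)) q).
  by apply/matrixP => j k; rewrite mxE.
move: (chart_at (F q)) (chart_at_atlas (F q)) (chart_at_dom (F q)) => c ca dFq'.
rewrite (pullback_chart i ba ca da) // (jac_chart ba ca da) //.
(* By tangency the pullback is [y *m jac]; the right inverse recovers [y], and the factor [trans] is
   carried along. *)
have /submxP[y ->] := tangent i ba ca dq dFq'.
rewrite -[y *m _ *m row_inverse _]mulmxA mulmx_row_inverse ?mulmx1 ?mulmxA //.
exact: immersion.
Qed.

Lemma christoffel_induced b c q i : atlas L b -> atlas M c -> cdom b q ->
  cdom c (F q) -> christoffel induced b i q =
  pullback F b c D i q *m row_inverse (jac F b c q).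
Proof.
move=> ba ca dq dFq.
rewrite ((intertwinesP _ _ _).1 induced_intertwines b c q i ba ca dq dFq).
by rewrite -mulmxA mulmx_row_inverse ?mulmx1 //; exact: immersion.
Qed.

Lemma pullback_smooth b c i : atlas L b -> atlas M c ->
  msmooth b (F @^-1` cdom c) (pullback F b c D i).
Proof.
move=> ba ca j k; have hb := manifold_chart ba.
have oF := preimage_open sF ca; have sJ := jac_smooth sF ba ca.
have sO : msmooth b (F @^-1` cdom c) (pulled_symbols F b c D i).
  move=> r s; suff : csmooth b (F @^-1` cdom c) (fun q =>
      \sum_x jac F b c q i x * ((fun p => christoffel D c x p r s) \o F) q).
    by apply: csmooth_ext => // q _ _; rewrite summxE;
      apply: eq_bigr => x _; rewrite [RHS]mxE.
  apply: csmooth_sum => // x _; apply: csmoothM => //.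
  by apply: csmooth_comp => //; apply: christoffel_smooth => //; case: hD.
have : csmooth b (F @^-1` cdom c) (fun q => mpd b i (jac F b c) q j k +
    (jac F b c q *m pulled_symbols F b c D i q) j k).
  apply: csmoothD => //; first exact: msmooth_mpd.
  exact: csmooth_mulmx.
by apply: csmooth_ext => // q _ _; rewrite [RHS]mxE.
Qed.

Lemma induced_smooth b i : atlas L b -> msmooth b setT (christoffel induced b i).
Proof.
move=> ba j k; have hb := manifold_chart ba => r.
(* The chart at [F q] is frozen on a neighbourhood of [q], where the symbols are given by a smooth
   formula. *)
apply: diff_upto_local => q dq _.
have ca := chart_at_atlas (F q); have dFq := chart_at_dom (F q).
move: (chart_at (F q)) ca dFq => c ca dFq; exists (F @^-1` cdom c) => //.
move: r; rewrite -/(csmooth _ _ _).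
have oF := preimage_open sF ca; have sJ := jac_smooth sF ba ca.
have sJt : msmooth b (F @^-1` cdom c) (fun q => (jac F b c q)^T).
  move=> r s; apply: csmooth_ext (sJ s r) => // q' _ _.
  by rewrite [RHS]mxE.
have : csmooth b (F @^-1` cdom c) (fun q =>
    (pullback F b c D i q *m row_inverse (jac F b c q)) j k).
  apply: csmooth_mulmx => // [r s|r s]; first exact: pullback_smooth.
  apply: csmooth_mulmx => // r' s'; apply: csmooth_invmx => //.
    by move=> q' dq' Wq'; apply: gram_unitmx; exact: immersion.
  by move=> r'' s''; apply: csmooth_mulmx.
by apply: csmooth_ext => // q' dq' Wq'; rewrite (christoffel_induced i ba ca).
Qed.

(** For the transformation law, the pullback along [F = F \o id] is computed in both charts of [L];
    the injective Jacobian is then cancelled. *)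
Lemma induced_connection : connection induced.
Proof.
split=> [b i j k ba|].
  have := induced_smooth i ba j k; apply: csmooth_ext => //.
  - exact: manifold_chart ba.
  - exact: openT.
  - by move=> q _ _; rewrite mxE.
apply/intertwinesP => b b' q i ba ba' dq dq'.
move: (chart_at_atlas (F q)) (chart_at_dom (F q)).
move: (chart_at (F q)) => c ca dFq.
have /intertwinesP h := induced_intertwines.
have := pullback_comp (@id_smooth _ _ L) sF ba ba' ca induced D i dq dq' dFq.
rewrite big1 => [|x _]; last by rewrite h // subrr scaler0.
rewrite mulmx0 addr0.
have := jac_comp (@id_smooth _ _ L) sF ba ba' ca dq dq' dFq.
rewrite -[(F \o id)]/F h // => ->; rewrite mulmxA => /esym.
exact: row_free_inj (immersion ba' ca dq' dFq) _ _.
Qed.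

Lemma hess_sym b c q i j k : atlas L b -> atlas M c -> cdom b q ->
  cdom c (F q) -> hess F b c q i j k = hess F b c q j i k.
Proof.
move=> ba ca dq dFq; have hb := manifold_chart ba.
have oF := preimage_open sF ca.
have [_ sFk] := sF; have sk := sFk b c ba ca k.
apply: (pd_sym hb oF) => // [q' dq' Wq'||].
- exact: csmooth_at sk dq' Wq'.
- exact: csmooth_at (csmooth_pd i sk) dq dFq.
- exact: csmooth_at (csmooth_pd j sk) dq dFq.
Qed.

Lemma induced_torsion_free : torsion_free D -> torsion_free induced.
Proof.
move=> tf b q i j k ba dq.
move: (chart_at_atlas (F q)) (chart_at_dom (F q)).
move: (chart_at (F q)) => c ca dFq.
suff E : row j (christoffel induced b i q) = row i (christoffel induced b j q).
  by have /rowP/(_ k) := E; rewrite !mxE.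
apply: (row_free_inj (immersion ba ca dq dFq)); rewrite -!row_mul.
have /intertwinesP h := induced_intertwines.
rewrite -!h //; apply/rowP => l; rewrite [LHS]mxE [RHS]mxE !pullbackE.
rewrite (hess_sym i j l ba ca dq dFq).
apply: (congr1 (fun z => hess F b c q j i l + z)).
rewrite exchange_big; apply: eq_bigr => x _; apply: eq_bigr => y _ /=.
by rewrite (tf c (F q) y x) //; ring.
Qed.

Lemma pulled_symbols_pd b c q i j : atlas L b -> atlas M c -> cdom b q ->
  cdom c (F q) ->
  mpd b i (pulled_symbols F b c D j) q =
  \sum_y hess F b c q i j y *: christoffel D c y (F q) +
  \sum_x \sum_y (jac F b c q i x * jac F b c q j y) *:
    mpd c x (christoffel D c y) (F q).
Proof.
move=> ba ca dq dFq; have hb := manifold_chart ba.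
have dJ := msmooth_diff (jac_smooth sF ba ca) dq dFq.
have dG y : mdiff c (christoffel D c y) (F q).
  by apply: mdiff_christoffel => //; case: hD.
have dGF y : mdiff b (christoffel D c y \o F) q.
  by move=> r s; exact: (diff_at_comp sF ba ca dq dFq (dG y r s)).1.
rewrite (mpd_sum i (fun y => mdiffZ (dJ j y) (dGF y))).
rewrite exchange_big -big_split; apply: eq_bigr => y _ /=.
rewrite (mpdZ hb i dq (dJ j y) (dGF y)) (mpd_comp sF ba ca i dq dFq (dG y)).
congr (_ *: _ + _).
  by rewrite /hess; congr pd; apply/funext => q'; rewrite mxE.
rewrite scaler_sumr; apply: eq_bigr => x _.
by rewrite scalerA mulrC.
Qed.

Lemma pulled_symbols_mul b c q i j :
  pulled_symbols F b c D j q *m pulled_symbols F b c D i q =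
  \sum_x \sum_y (jac F b c q i x * jac F b c q j y) *:
    (christoffel D c y (F q) *m christoffel D c x (F q)).
Proof.
rewrite /pulled_symbols mulmx_sumr; apply: eq_bigr => x _.
rewrite mulmx_suml; apply: eq_bigr => y _.
by rewrite -scalemxAr -scalemxAl scalerA.
Qed.

(** The curvature of the pulled back connection is the pullback of the curvature: the terms in
    second derivatives of [F] are symmetric in [i] and [j] and cancel. *)
Lemma pulled_curvature b c q i j : atlas L b -> atlas M c -> cdom b q ->
  cdom c (F q) ->
  mpd b i (pulled_symbols F b c D j) q - mpd b j (pulled_symbols F b c D i) q +
  pulled_symbols F b c D j q *m pulled_symbols F b c D i q -
  pulled_symbols F b c D i q *m pulled_symbols F b c D j q =
  \sum_x \sum_y (jac F b c q i x * jac F b c q j y) *: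
    riemann D c x y (F q).
Proof.
move=> ba ca dq dFq; rewrite !pulled_symbols_mul.
have eh : \sum_y hess F b c q i j y *: christoffel D c y (F q) =
    \sum_y hess F b c q j i y *: christoffel D c y (F q).
  apply: eq_bigr => y _.
  exact (f_equal (fun z : R => z *: christoffel D c y (F q))
    (hess_sym i j y ba ca dq dFq)).
have := pulled_symbols_pd j i ba ca dq dFq.
have := etrans (pulled_symbols_pd i j ba ca dq dFq) (congr1 (fun z => z + _) eh).
move: (\sum_y hess F b c q j i y *: _) => S -> ->.
rewrite opprD addrACA subrr add0r.
rewrite [X in _ - X + _ - _]exchange_big [X in _ - X]exchange_big /=.
rewrite -sumrB -big_split -sumrB; apply: eq_bigr => x _ /=.
rewrite -sumrB -big_split -sumrB; apply: eq_bigr => y _ /=.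
by rewrite [jac _ _ _ _ j y * _]mulrC -scalerBr -scalerDr -scalerBr.
Qed.

(* Symmetry of the mixed derivatives of [jac F b c], the first derivatives of
   which are given by [induced * jac = pullback]. *)
Lemma induced_curvature b c q i j : atlas L b -> atlas M c -> cdom b q ->
  cdom c (F q) ->
  riemann induced b i j q *m jac F b c q =
  jac F b c q *m \sum_x \sum_y (jac F b c q i x * jac F b c q j y) *:
    riemann D c x y (F q).
Proof.
move=> ba ca dq dFq; rewrite -(pulled_curvature i j ba ca dq dFq).
have hb := manifold_chart ba; have oF := preimage_open sF ca.
have sJ := jac_smooth sF ba ca; have dJ := msmooth_diff sJ dq dFq.
have E1 k q' : cdom b q' -> cdom c (F q') -> mpd b k (jac F b c) q' =
    christoffel induced b k q' *m jac F b c q' -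
    jac F b c q' *m pulled_symbols F b c D k q'.
  move=> dq' dFq'; have /intertwinesP h := induced_intertwines.
  by rewrite -h // /pullback addrK.
have dE k : mdiff b (christoffel induced b k) q.
  exact: msmooth_diff (induced_smooth k ba) dq I.
have dO k : mdiff b (pulled_symbols F b c D k) q.
  apply: mdiff_sum => y; apply: mdiffZ; first exact: dJ.
  have dG : mdiff c (christoffel D c y) (F q).
    by apply: mdiff_christoffel => //; case: hD.
  by move=> r s; exact: (diff_at_comp sF ba ca dq dFq (dG r s)).1.
have E2 k l : mpd b l (mpd b k (jac F b c)) q =
    (mpd b l (christoffel induced b k) q *m jac F b c q +
     christoffel induced b k q *m mpd b l (jac F b c) q) -
    (mpd b l (jac F b c) q *m pulled_symbols F b c D k q +
     jac F b c q *m mpd b l (pulled_symbols F b c D k) q).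
  have dEJ := mdiffM (dE k) dJ; have dJO := mdiffM dJ (dO k).
  rewrite (mpd_near hb l oF dq dFq (fun q' dq' Wq' => E1 k q' dq' Wq')).
  rewrite (mpdD l dEJ (mdiffN dJO)) (mpdN l dJO).
  by rewrite (mpdM hb l dq (dE k) dJ) (mpdM hb l dq dJ (dO k)).
(* The two orders of differentiation are equated. Replacing the remaining first derivatives by [E1]
   cancels the mixed products and leaves the two curvatures. *)
have := etrans (esym (E2 j i)) (etrans (mpd_sym hb i j oF sJ dq dFq) (E2 i j)).
rewrite (E1 i q dq dFq) (E1 j q dq dFq) /riemann.
move: (mpd b i (christoffel _ _ j) q) (mpd b j (christoffel _ _ i) q).
move: (mpd b i (pulled_symbols _ _ _ _ j) q) (mpd b j (pulled_symbols _ _ _ _ i) q).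
move: (christoffel _ _ i q) (christoffel _ _ j q).
move: (pulled_symbols _ _ _ _ i q) (pulled_symbols _ _ _ _ j q) (jac F b c q).
move=> Oi Oj J Ei Ej dOj dOi dEj dEi; mulmx_expand => /eqP.
rewrite -subr_eq0 => /eqP h; apply/eqP; rewrite -subr_eq0 -h; apply/eqP.
matrix_abel.
Qed.

End InducedConnection.

(** * Leaves of the foliation *)

(** Two normals [n] and [n'] of the same [u] differ by a multiple of [u], and [df(u) = 0]. *)
Lemma normal_differential (R : realType) (M : manifold R 3)
    (g : chart R 3 M -> M -> 'M[R]_3) (T : chart R 3 M -> M -> 'rV[R]_3)
    (D : symbols M) (u v n v' n' : chart R 3 M -> M -> 'rV[R]_3) (f : M -> R)
    (c : chart R 3 M) (p : M) :
  skew_torsion_manifold g T D u f ->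
  null_coframe g u v n -> null_coframe g u v' n' -> atlas M c -> cdom c p ->
  dot (n' c p *m invmx (g c p)) (differential f c p) =
  dot (n c p *m invmx (g c p)) (differential f c p).
Proof.
case=> _ _ hg _ _ hD hf hu u0 hiso heq hvn hvn' ca dp.
set H := invmx (g c p); set df := differential f c p.
have du := differential_u hg hD hf hu hiso heq hvn ca dp.
have wE (x : 'rV[R]_3) : (n c p *m H) *m wedge1 x (u c p) =
    dot (n c p *m H) x *: u c p - dot (n c p *m H) (u c p) *: x.
  rewrite /wedge1 mulmxBr !mulmxA.
  by congr (_ - _); rewrite [X in X *m _]mx11_scalar mul_scalar_mx.
have Nu : dot (n c p *m H) (u c p) = 0 := dotNu_at hg hvn ca dp.
have Nn : dot (n c p *m H) (n c p) = 1 := dotNn_at hg hiso hvn ca dp.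
(* Both [n /\ u] and [n' /\ u] are the Hodge dual of [u]; contraction with [n^#] compares the
   coefficients of the nonzero form [u]. *)
have Nn' : dot (n c p *m H) (n' c p) = 1.
  have e : wedge1 (n c p) (u c p) = wedge1 (n' c p) (u c p).
    by rewrite -(star1_at hg hiso hvn ca dp) -(star1_at hg hiso hvn' ca dp).
  have := wE (n' c p); rewrite -e wE Nu Nn !scale0r !subr0 scale1r.
  move=> /eqP; rewrite eq_sym -{2}[u c p]scale1r -subr_eq0 -scalerBl scaler_eq0.
  by rewrite (negPf (u0 c p ca dp)) orbF subr_eq0 => /eqP.
have Un' : dot (u c p *m H) (n' c p) = 0.
  by rewrite (dot_sharpC (metric_sym hg ca dp)); exact (dotNu_at hg hvn' ca dp).
have tE (A B : 'rV[R]_3) : n' c p *m A^T *m B = dot A (n' c p) *: B.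
  by rewrite dotC [X in X *m _]mx11_scalar mul_scalar_mx.
have -> : n' c p = dot (v c p *m H) (n' c p) *: u c p + n c p.
  rewrite -[LHS]mulmx1 -(resolution_at hg hiso hvn ca dp) -/H.
  by rewrite !mulmxDr !mulmxA !tE Un' Nn' scale0r add0r scale1r.
have dD (x : R) (A B C : 'rV[R]_3) : dot (x *: A + B) C = x * dot A C + dot B C.
  by rewrite !dotE !mxE; ring.
by rewrite mulmxDl -scalemxAl dD du mulr0 add0r.
Qed.

Section Leaf.
Context (R : realType) (M : manifold R 3) (g : chart R 3 M -> M -> 'M[R]_3).
Context (T : chart R 3 M -> M -> 'rV[R]_3) (D : symbols M).
Context (u v n : chart R 3 M -> M -> 'rV[R]_3) (f : M -> R).
Hypotheses (hM : skew_torsion_manifold g T D u f) (hvn : null_coframe g u v n).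
Hypothesis hflat : flatness_condition g f n.
Context (L : manifold R 2) (F : L -> M).
Hypothesis hF : integral_surface u F.

Let sF : smooth_map F. Proof. by case: hF. Qed.
Let hD : connection D. Proof. by case: (st_levi_civita hM). Qed.

Lemma leaf_immersion b c q : atlas L b -> atlas M c -> cdom b q ->
  cdom c (F q) -> row_free (jac F b c q).
Proof. by case: hF => _ _ h *; case: (h b c q). Qed.

Lemma jac_u b c q : atlas L b -> atlas M c -> cdom b q -> cdom c (F q) ->
  jac F b c q *m (u c (F q))^T = 0.
Proof.
case: hF => _ _ h ba ca dq dFq; have [_ /andP[s _]] := h b c q ba ca dq dFq.
exact/sub_kermxP.
Qed.

Lemma sub_jac b c q (x : 'M[R]_(2, 3)) : atlas L b -> atlas M c -> cdom b q ->
  cdom c (F q) -> x *m (u c (F q))^T = 0 -> (x <= jac F b c q)%MS.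
Proof.
case: hF => _ _ h ba ca dq dFq /sub_kermxP xk.
by have [_ /andP[_ s]] := h b c q ba ca dq dFq; exact: submx_trans xk s.
Qed.

(* [nabla u = f (n (x) u - u (x) n)] vanishes on [ker u]. *)
Lemma leaf_tangent b c q i : atlas L b -> atlas M c -> cdom b q ->
  cdom c (F q) -> (pullback F b c D i q <= jac F b c q)%MS.
Proof.
move=> ba ca dq dFq; apply: sub_jac => //.
have hb := manifold_chart ba; have oF := preimage_open sF ca.
have [_ _ hg _ _ hLC hf hu _ hiso heq] := hM.
have dJ := msmooth_diff (jac_smooth sF ba ca) dq dFq.
have su := form_smooth ca hu.
have du := msmooth_diff su dFq I.
have duF : mdiff b (u c \o F) q.
  by move=> r s; exact: (diff_at_comp sF ba ca dq dFq (du r s)).1.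
(* The relation [jac *m u^T = 0] is differentiated along the leaf. By [S0] the covariant derivative
   of [u] in a tangent direction is a multiple of [u], so it pairs to zero with the Jacobian and
   what remains is [pullback *m u^T = 0]. *)
have : mpd b i (fun q => jac F b c q *m ((u c \o F) q)^T) q = 0.
  rewrite -(mpd_cst b i (0 : 'M[R]_(2, 1)) q).
  by apply: (mpd_near hb i oF dq dFq) => q' dq' Wq'; exact: jac_u.
rewrite (mpdM hb i dq dJ (mdiff_tr duF)) mpd_tr.
rewrite (mpd_comp sF ba ca i dq dFq du) => e.
have duE x : mpd c x (u c) (F q) = nabla D c x (u c) (F q) +
    u c (F q) *m (christoffel D c x (F q))^T by rewrite /nabla subrK.
have nu x : nabla D c x (u c) (F q) = f (F q) *:
    (n c (F q) 0 x *: u c (F q) - u c (F q) 0 x *: n c (F q)).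
  exact (nabla_u hg hiso heq hvn ca x dFq).
have S0 : jac F b c q *m (\sum_x jac F b c q i x *:
    nabla D c x (u c) (F q))^T = 0.
  have -> : \sum_x jac F b c q i x *: nabla D c x (u c) (F q) =
      (f (F q) * \sum_x jac F b c q i x * n c (F q) 0 x) *: u c (F q) -
      (f (F q) * (jac F b c q *m (u c (F q))^T) i 0) *: n c (F q).
    rewrite [(_ *m _) i 0]mxE !mulr_sumr !scaler_suml -sumrB; apply: eq_bigr => x _.
    rewrite nu [(u c (F q))^T _ _]mxE.
    by apply/rowP => k; rewrite !mxE; ring.
  have -> : (jac F b c q *m (u c (F q))^T) i 0 = 0.
    by rewrite (jac_u ba ca dq dFq) mxE.
  rewrite mulr0 scale0r subr0.
  by rewrite linearZ -scalemxAr (jac_u ba ca dq dFq) scaler0.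
rewrite /pullback mulmxDl; apply: etrans e; apply: (congr1 (fun z => _ + z)).

rewrite -[LHS]addr0 -S0 -mulmxA -mulmxDr; congr (_ *m _).
apply: trmx_inj; rewrite trmxD !trmx_mul !trmxK.
rewrite /pulled_symbols [X in _ *m X + _]linear_sum mulmx_sumr addrC -big_split.
apply: eq_bigr => x _ /=.
rewrite duE [in LHS]linearZ /= -scalemxAr.
by rewrite -scalerDr.
Qed.

(** The rows of the Jacobian lie in [ker u], so the pulled back curvature is an instance of
    [riemann2_kernel]; full row rank transfers its vanishing to the leaf. *)
Lemma leaf_flat : flat (induced F D).
Proof.
move=> b q i j k l ba dq.
have ca := chart_at_atlas (F q); have dFq := chart_at_dom (F q).
move: (chart_at (F q)) ca dFq => c ca dFq.
have [_ _ hg _ _ hLC hf hu _ hiso heq] := hM.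
have h := induced_curvature sF hD leaf_immersion leaf_tangent i j ba ca dq dFq.
rewrite -riemannE; suff -> : riemann (induced F D) b i j q = 0 by rewrite mxE.
apply: (row_free_inj (leaf_immersion ba ca dq dFq)); rewrite mul0mx h.
have rowu a : dot (row a (jac F b c q)) (u c (F q)) = 0.
  by rewrite /dot -row_mul (jac_u ba ca dq dFq) !mxE.
have flat_n : dot (n c (F q) *m invmx (g c (F q))) (differential f c (F q)) +
    f (F q) ^+ 2 = 0 by rewrite dotC; exact: hflat.
have := riemann2_kernel hg hLC hf hu hiso heq hvn ca dFq flat_n (rowu i) (rowu j).
move=> e; rewrite (_ : \sum_x _ = 0) ?mulmx0 // -[RHS]e.
by apply: eq_bigr => x _; apply: eq_bigr => y _; rewrite ![row _ _ _ _]mxE.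
Qed.

End Leaf.

Theorem proposition4p16 (R : realType) (M : manifold R 3)
    (g : chart R 3 M -> M -> 'M[R]_3) (T : chart R 3 M -> M -> 'rV[R]_3)
    (D : symbols M) (u : chart R 3 M -> M -> 'rV[R]_3) (f : M -> R)
    (hM : skew_torsion_manifold g T D u f)
    (hf : exists v n, null_coframe g u v n /\ flatness_condition g f n) :
  (forall v n, null_coframe g u v n -> flatness_condition g f n) /\
  leafwise_affine u D.
Proof.
have [v [n [hvn hflat]]] := hf; split=> [v' n' hvn' c p ca dp|L F [hF _ _]].
  have h := normal_differential hM hvn hvn' ca dp.
  by rewrite -(hflat c p ca dp); congr (_ + _); rewrite dotC in h;
     rewrite [RHS]dotC in h.
have [hD tf _] := st_levi_civita hM; have [sF _ _] := hF.
have im := leaf_immersion hF; have tg := leaf_tangent hM hvn hF.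
exists (induced F D); split.
- exact: induced_connection.
- exact: induced_intertwines.
- exact: induced_torsion_free.
- exact (leaf_flat hM hvn hflat hF).
Qed.
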